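(* Let $0<q<1$ and let $G$ be a finite abelian group. Then there exist $c,K>0$ such that for all $n$, if $\Gamma\in G(n,q)$ is an Erdős–Rényi random graph and $S$ is its sandpile group, then $$\left|\mathbb{E}(\#\operatorname{Sur}(S,G))-|\wedge^2G|\right|\le Ke^{-cn}.$$
   Context: $\operatorname{Sur}(A,B)$ is the set of surjective group homomorphisms $A\to B$. $\wedge^2G$ is the quotient of $G\otimes_{\mathbb{Z}} G$ by the subgroup generated by the elements $g\otimes g$. $G(n,q)$: random graph on the labeled vertex set $[n]=\{1,\dots,n\}$ in which each of the $\binom n2$ possible edges is present independently with probability $q$. Sandpile group: for a graph $\Gamma$ on $[n]$, the Laplacian $L_\Gamma$ is the $n\times n$ integer matrix with $(i,j)$ entry $1$ if $i\neq j$ and $\{i,j\}$ is an edge, $0$ if $i\ne j$ and $\{i,j\}$ is not an edge, and $-\deg(i)$ if $i=j$. Let $Z\subset\mathbb{Z}^n$ be the subgroup of vectors whose coordinates sum to $0$. The column space (image) of $L_\Gamma$ is contained in $Z$, and the sandpile group of $\Gamma$ is $Z/L_\Gamma\mathbb{Z}^n$. This is a finitely generated abelian group, finite if and only if $\Gamma$ is connected. *)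

(* Defs.v *)
From HB Require Import structures.
From mathcomp Require Import all_boot all_order all_algebra.
From mathcomp Require Import finmap.
From mathcomp Require Import generic_quotient ring_quotient.
From mathcomp Require Import all_classical all_reals all_analysis.

Set Implicit Arguments.
Unset Strict Implicit.
Unset Printing Implicit Defensive.

Import Order.TTheory GRing.Theory Num.Theory.

Local Open Scope classical_set_scope.
Local Open Scope ring_scope.

(* The cardinality is the true one only for finite sets (fset_set sends every
   infinite set to the empty one); the sets to which it is applied are shown to
   be finite in finite_sandpile_Sur and finite_ext2. *)
Definition ncard (T : choiceType) (A : set T) : nat := #|` fset_set A|%fset.

Definition Sur (A B : zmodType) : set (A -> B) :=
  [set f | zmod_morphism f /\ set_surj [set: A] [set: B] f].
Arguments Sur : clear implicits.

(* zmodClosed V is the type of (boolean predicates on V that are) subgroups *)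
Section generated_subgroup.
Variables (V : zmodType) (A : set V).

Definition zgen : {pred V} :=
  fun x => `[< forall H : zmodClosed V, A `<=` [set y | y \in H] -> x \in H >].

Lemma zgen_zmod_closed : zmod_closed zgen.
Proof.
split=> [|x y /asboolP xA /asboolP yA]; apply/asboolP => H AH.
  exact: rpred0.
by apply: rpredB; [exact: xA|exact: yA].
Qed.

HB.instance Definition _ := GRing.isZmodClosed.Build V zgen zgen_zmod_closed.

Lemma sub_zgen x : A x -> x \in zgen.
Proof. by move=> Ax; apply/asboolP => H; apply. Qed.

End generated_subgroup.

(* A (x)_Z B is the free abelian group {ffun A * B -> int} on the finite set
   A * B modulo the bilinearity relations; tensor_gen a b is the basis
   element indexed by (a, b) and tens a b its class. *)
Section tensor.
Variables A B : finZmodType.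

Definition tensor_gen (a : A) (b : B) : {ffun A * B -> int} :=
  [ffun x => (x == (a, b))%:R].

Definition bilinear_relations : set {ffun A * B -> int} :=
  [set r | exists a a' b,
    r = tensor_gen (a + a') b - tensor_gen a b - tensor_gen a' b] `|`
  [set r | exists a b b',
    r = tensor_gen a (b + b') - tensor_gen a b - tensor_gen a b'].

Definition tensor : zmodType := Quotient.quot (zgen bilinear_relations).

Definition tens (a : A) (b : B) : tensor :=
  \pi_(Quotient.quot (zgen bilinear_relations))%qT (tensor_gen a b).

End tensor.
Arguments bilinear_relations : clear implicits.

Definition ext2 (G : finZmodType) : zmodType :=
  Quotient.quot (zgen [set tens g g | g in [set: G]]).

(* Simple graphs on 'I_n, with vertex i standing for i + 1 in {1, ..., n};
   an edge is a 2-element set of vertices. *)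
Definition all_edges (n : nat) : {set {set 'I_n}} :=
  [set e : {set 'I_n} | #|e| == 2%N].

Record simple_graph (n : nat) := SimpleGraph {
  edges : {set {set 'I_n}};
  edges_sub : edges \subset all_edges n }.

HB.instance Definition _ n := [isSub for @edges n].
HB.instance Definition _ n := [Finite of simple_graph n by <:].

Definition adj n (g : simple_graph n) (i j : 'I_n) : bool :=
  [set i; j]%SET \in edges g.

Definition degree n (g : simple_graph n) (i : 'I_n) : nat :=
  #|[set j | adj g i j]%SET|.

Definition laplacian n (g : simple_graph n) : 'M[int]_n :=
  \matrix_(i, j) if i == j then - (degree g i)%:Z else (adj g i j : nat)%:Z.

(* Z, the vectors of int^n whose coordinates sum to 0 *)
Section sum_zero.
Variable n : nat.

Definition sum_zero : {pred 'cV[int]_n} := fun v => \sum_(i < n) v i 0 == 0.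

Lemma sum_zero_zmod_closed : zmod_closed sum_zero.
Proof.
split=> [|u v /eqP u0 /eqP v0]; apply/eqP.
  by rewrite big1// => i _; rewrite mxE.
under eq_bigr do rewrite !mxE.
by rewrite sumrB u0 v0 subrr.
Qed.

HB.instance Definition _ :=
  GRing.isZmodClosed.Build 'cV[int]_n sum_zero sum_zero_zmod_closed.

Record zsum_zero := ZSumZero {
  zsum_zero_val :> 'cV[int]_n;
  zsum_zeroP : zsum_zero_val \in sum_zero }.

HB.instance Definition _ := [isSub for zsum_zero_val].
HB.instance Definition _ := [Choice of zsum_zero by <:].
HB.instance Definition _ := [SubChoice_isSubZmodule of zsum_zero by <:].

End sum_zero.

Section sandpile.
Variables (n : nat) (g : simple_graph n).

Lemma adjC i j : adj g i j = adj g j i.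
Proof. by rewrite /adj finset.setUC. Qed.

Lemma adjxx i : adj g i i = false.
Proof.
apply/negP => /(fintype.subsetP (edges_sub g)).
by rewrite inE finset.setUid cards1.
Qed.

Lemma laplacian_sum_zero (x : 'cV[int]_n) : laplacian g *m x \in @sum_zero n.
Proof.
apply/eqP; under eq_bigr do rewrite mxE.
rewrite exchange_big big1//= => j _.
rewrite -mulr_suml (bigD1 j)//= mxE eqxx /degree cardsE -sum1_card.
rewrite -natz natr_sum [X in - X + _]big_mkcond.
rewrite [X in _ + X]big_mkcond addrC -sumrB big1 ?mul0r// => i _.
rewrite mxE -[i \in _]/(adj g j i); case: eqVneq => [->|_] /=.
  by rewrite adjxx subr0.
by rewrite adjC; case: adj; rewrite subrr.
Qed.

Definition laplacian_image : {pred zsum_zero n} :=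
  fun z => `[< exists x : 'cV[int]_n, val z = laplacian g *m x >].

Lemma laplacian_image_zmod_closed : zmod_closed laplacian_image.
Proof.
split=> [|u v /asboolP[x ux] /asboolP[y vy]]; apply/asboolP.
  by exists 0; rewrite mulmx0.
by exists (x - y); rewrite mulmxBr -ux -vy.
Qed.

HB.instance Definition _ := GRing.isZmodClosed.Build (zsum_zero n)
  laplacian_image laplacian_image_zmod_closed.

Definition sandpile : zmodType := Quotient.quot laplacian_image.

End sandpile.

Section finiteness.

Lemma finite_set_code (T : choiceType) (F : finType) (c : T -> F) (A : set T) :
  {in A &, injective c} -> finite_set A.
Proof.
move=> inj; have [->|/set0P[x0 _]] := eqVneq A set0; first exact: finite_set0.
pose d t := xget x0 [set x | A x /\ c x = t].
apply: (@sub_finite_set _ _ (d @` [set: F])); last first.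
  exact/finite_image/finite_finset.
move=> x Ax; exists (c x) => //; rewrite /d.
case: xgetP => [y _ [Ay cyx]|/(_ x)[]//].
by apply: inj => //; apply/mem_set.
Qed.

Lemma sum_zero_delta n (i j : 'I_n) :
  delta_mx i 0 - delta_mx j 0 \in @sum_zero n.
Proof.
have sum1 k : \sum_(l < n) ((l == k)%:R : int) = 1.
  by rewrite (bigD1 k)//= eqxx big1 ?addr0// => l /negPf->.
apply/eqP; under eq_bigr do rewrite !mxE !andbT.
by rewrite sumrB !sum1 subrr.
Qed.

Lemma finite_sandpile_Sur n (g : simple_graph n) (G : finZmodType) :
  finite_set (Sur (sandpile g) G).
Proof.
pose e (ij : 'I_n * 'I_n) : zsum_zero n := ZSumZero (sum_zero_delta ij.1 ij.2).
pose p (z : zsum_zero n) : sandpile g := \pi_(Quotient.quot (laplacian_image g))%qT z.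
pose c (f : sandpile g -> G) := [ffun ij => f (p (e ij))].
apply: (@finite_set_code _ _ c) => f1 f2 /set_mem[m1 _] /set_mem[m2 _] f12.
pose F1 : {additive _ -> _} :=
  HB.pack f1 (GRing.isZmodMorphism.Build _ _ f1 m1).
pose F2 : {additive _ -> _} :=
  HB.pack f2 (GRing.isZmodMorphism.Build _ _ f2 m2).
apply/funext => z; rewrite -[z]reprK; set v : zsum_zero n := repr z.
change (F1 (p v) = F2 (p v)).
have e12 ij : F1 (p (e ij)) = F2 (p (e ij)).
  by have /ffunP/(_ ij) := f12; rewrite !ffunE.
case: n g @e @p @c f1 f2 f12 m1 m2 F1 F2 z @v e12 => [|n] g e p c f1 f2 _ m1 m2 F1 F2 z v e12.
  rewrite (_ : v = 0) ?raddf0//.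
    by rewrite [p 0]raddf0 !raddf0.
  by apply/val_inj/matrixP => -[].
have -> : v = \sum_i e (i, ord0) *~ val v i 0.
  apply/val_inj; rewrite raddf_sum.
  rewrite (eq_bigr (fun i => val (e (i, ord0)) *~ val v i 0)); last first.
    by move=> i _; rewrite raddfMz.
  apply/matrixP => i j; rewrite (ord1 j) summxE.
  under eq_bigr => k _ do rewrite -scaler_int !mxE/= !andbT mulrBr intz.
  rewrite sumrB -mulr_suml (eqP (zsum_zeroP v)) mul0r subr0.
  rewrite (bigD1 i)//= eqxx mulr1 big1 ?addr0// => k /negPf ki.
  by rewrite eq_sym ki mulr0.
rewrite [p _]raddf_sum !raddf_sum; apply: eq_bigr => i _.
by rewrite raddfMz !raddfMz; congr (_ *~ _); exact: e12.
Qed.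

Lemma finite_ext2 (G : finZmodType) : finite_set [set: ext2 G].
Proof.
pose p1 (h : {ffun G * G -> int}) : tensor G G :=
  \pi_(Quotient.quot (zgen (bilinear_relations G G)))%qT h.
pose p2 (t : tensor G G) : ext2 G :=
  \pi_(Quotient.quot (zgen [set tens g g | g in [set: G]]))%qT t.
pose tr (f : G * G -> int) : {ffun G * G -> int} := [ffun x => f x].
pose m (f : {ffun G * G -> 'I_#|G|.+1}) : ext2 G := p2 (p1 (tr (fun x => Posz (f x)))).
apply: (@sub_finite_set _ _ (m @` [set: _])); last first.
  exact/finite_image/finite_finset.
have tensD a a' b : tens (a + a') b = tens a b + tens a' b :> tensor G G.
  have : tensor_gen (a + a') b - tensor_gen a b - tensor_gen a' b
      \in zgen (bilinear_relations G G).
    by apply: sub_zgen; left; exists a, a', b.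
  rewrite -addrA -opprD Quotient.idealrBE => /eqP E.
  by rewrite /tens E [LHS]raddfD.
have tensM a b k : tens (a *+ k) b = tens a b *+ k :> tensor G G.
  elim: k => [|k IH]; last by rewrite !mulrS tensD IH.
  by apply: (addrI (tens 0 b)); rewrite mulr0n -tensD !addr0.
have card0 (a : G) : a *+ #|G| = 0.
  apply: (addrI (\sum_(x : G) x)).
  by rewrite addr0 [RHS](reindex_inj (addIr a)) big_split sumr_const.
have ffunMzE (h : {ffun G * G -> int}) k y : (h *~ k) y = h y *~ k.
  by case: k => k; rewrite ?NegzE ?mulrNz ?ffunE -!pmulrn ffunMnE.
have trE f : p1 (tr f) = \sum_x tens x.1 x.2 *~ f x.
  have -> : tr f = \sum_x tensor_gen x.1 x.2 *~ f x.
    apply/ffunP => y; rewrite ffunE sum_ffunE (bigD1 y)//= big1 ?addr0.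
      by rewrite ffunMzE !ffunE -surjective_pairing eqxx/= intz.
    move=> x xy; rewrite ffunMzE !ffunE -surjective_pairing.
    by rewrite eq_sym (negPf xy) mul0rz.
  by rewrite [LHS]raddf_sum; apply: eq_bigr => x _; rewrite raddfMz.
have N0 : (#|G| : int) != 0 by rewrite eqz_nat -lt0n; apply/card_gt0P; exists 0.
move=> x _; rewrite -[x]reprK -[repr x]reprK; set h := repr (repr x).
pose r z := (z %% #|G|)%Z.
have r0 z : 0 <= r z by exact: modz_ge0.
exists [ffun y => inord `|r (h y)|%N] => //.
rewrite /m; congr p2; transitivity (p1 (tr h)); last first.
  by congr p1; apply/ffunP => y; rewrite ffunE.
rewrite !trE; apply: eq_bigr => y _; rewrite ffunE inordK; last first.
  rewrite ltnS -lez_nat gez0_abs//; by apply/ltW/ltz_pmod; rewrite lt0r N0.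
rewrite gez0_abs//; have := divz_eq (h y) #|G|; rewrite -/(r (h y)).
move: (r _) => s ->; rewrite mulrzDr mulrC mulrzA -pmulrn -tensM card0.
by rewrite -(mulr0n 0) tensM mulr0n mul0rz add0r.
Qed.

End finiteness.

Section random_graph.
Local Open Scope ereal_scope.
Variables (d : measure_display) (T : measurableType d) (R : realType).
Variable P : probability T R.

Definition mutually_independent (I : finType) (D : {set I}) (E : I -> set T) :=
  forall J : {set I}, J \subset D ->
    P (\bigcap_(i in [set` J]) E i) = \prod_(i in J) P (E i).

(* Gamma is an instance of G(n, q), over an arbitrary probability space *)
Definition erdos_renyi (n : nat) (q : R) (Gamma : T -> simple_graph n) :=
  let present e := [set w | e \in edges (Gamma w)] in
  [/\ forall e, e \in all_edges n -> measurable (present e),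
      forall e, e \in all_edges n -> P (present e) = q%:E &
      mutually_independent (all_edges n) present].

End random_graph.

(* Main.v *)
Require Import Defs.
From HB Require Import structures.
From mathcomp Require Import all_boot all_order all_algebra all_fingroup.
From mathcomp Require Import all_field all_character complex.
From mathcomp Require Import finmap generic_quotient ring_quotient.
From mathcomp Require Import all_classical all_reals all_analysis.
From mathcomp Require Import measurable_realfun.
From mathcomp Require Import zify ring lra.

Set Implicit Arguments.
Unset Strict Implicit.
Unset Printing Implicit Defensive.

Import Order.TTheory GRing.Theory Num.Theory.

Local Open Scope ring_scope.

(* Let k = |G| and let D be the dual of G. A surjection from the sandpile group
   is a labelling of the vertices by G, up to translation, whose differences
   generate G and which kills every column of the Laplacian. Expanding that last
   condition in characters, one for each vertex, and averaging over the
   independent edges gives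
     k^(n+1) E(#Sur) = sum over x : [n] -> D x G with generating second
       coordinates of prod_(i < j) (1 - q + q chi(Q(x_i - x_j))),
   where Q(c, g) = c(g). A factor is 1 if Q(x_i - x_j) = 0 ("compatible") and has
   modulus at most r^2 < 1 otherwise. Cliques, the pairwise compatible subsets of D x G,
   have at most k elements, by Parseval for the polarization of Q. The maximal ones
   that project to generating sets are the graphs of the maps c + psi with psi
   an alternating form on G, so there are k |wedge^2 G| of them, and the maps x
   onto such graphs give the main term. For any other x consider the set H of
   points of D x G taken by a positive proportion of the vertices. If H contains
   an incompatible pair, the weight is exp(-c n^2); if H is a clique with fewer
   than k points, there are exponentially fewer than k^n such x; if H is a clique
   with k points, each of the vertices mapped outside H, of which there is at
   least one, contributes a factor exp(-c n). *)

(** * Duality for finite abelian groups *)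

Section dual.
Variables (N : nat) (A : finZmodType).

Definition is_char : {pred {ffun A -> 'Z_N}} :=
  fun f => [forall a, forall b, f (a + b) == f a + f b].

Lemma is_char_zmod_closed : zmod_closed is_char.
Proof.
split=> [|f h /forallP fD /forallP hD]; apply/forallP => a; apply/forallP => b.
  by rewrite !ffunE addr0.
rewrite !ffunE (eqP (forallP (fD a) b)) (eqP (forallP (hD a) b)).
by rewrite opprD addrACA.
Qed.

HB.instance Definition _ :=
  GRing.isZmodClosed.Build {ffun A -> 'Z_N} is_char is_char_zmod_closed.

Record dual : predArgType := Dual {
  dual_val :> {ffun A -> 'Z_N};
  dualP : dual_val \in is_char }.

HB.instance Definition _ := [isSub for dual_val].
HB.instance Definition _ := [Finite of dual by <:].
HB.instance Definition _ := [SubChoice_isSubZmodule of dual by <:].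

Lemma dualD (c : dual) a b : c (a + b) = c a + c b.
Proof. by have /forallP/(_ a)/forallP/(_ b)/eqP := dualP c. Qed.

Lemma dual0 (c : dual) : c 0 = 0.
Proof. by apply: (addrI (c 0)); rewrite -dualD !addr0. Qed.

Lemma dualN (c : dual) a : c (- a) = - c a.
Proof. by apply: (addrI (c a)); rewrite -dualD !subrr dual0. Qed.

Lemma dualB (c : dual) a b : c (a - b) = c a - c b.
Proof. by rewrite dualD dualN. Qed.

Lemma dualMz (c : dual) a (m : int) : c (a *~ m) = c a *~ m.
Proof.
have dualMn j : c (a *+ j) = c a *+ j.
  by elim: j => [|j IH]; rewrite ?mulr0n ?dual0// !mulrS dualD IH.
by case: m => j; rewrite ?NegzE ?mulrNz ?dualN -!pmulrn dualMn.
Qed.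

Lemma dual_sum (c : dual) (I : finType) (Q : pred I) (F : I -> A) :
  c (\sum_(i | Q i) F i) = \sum_(i | Q i) c (F i).
Proof. exact: (big_morph c (dualD c) (dual0 c)). Qed.

Lemma dual_addE (c e : dual) a : (c + e) a = c a + e a.
Proof. by rewrite ffunE. Qed.

Lemma dual_oppE (c : dual) a : (- c) a = - c a.
Proof. by rewrite ffunE. Qed.

Lemma dual_subE (c e : dual) a : (c - e) a = c a - e a.
Proof. by rewrite dual_addE dual_oppE. Qed.

Lemma dual_zeroE a : (0 : dual) a = 0.
Proof. by rewrite ffunE. Qed.

Lemma dual_eq (c e : dual) : c =1 e -> c = e.
Proof. by move=> ce; apply/val_inj/ffunP. Qed.

End dual.

Lemma dual_separates (N : nat) (A : finZmodType) (a : A) : (1 < N)%N ->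
  (forall x : A, x *+ N = 0) -> a != 0 -> exists c : dual N A, c a != 0.
Proof.
move=> N1 tors a0.
have abA := FinRing.zmod_abelian [set: A].
have [i ai] : exists i, a \notin cfker 'chi[[set: A]]_i.
  apply/existsP; apply/contraT; rewrite negb_exists => /forallP ak.
  have /set1P/eqP : a \in [1 A]%g.
    rewrite -(TI_cfker_irr [set: A]); apply/bigcapP => i _.
    by have := ak i; rewrite negbK.
  by rewrite (negPf a0).
have lin : 'chi_i \is a linear_char by apply/char_abelianP.
have [z prz] := C_prim_root_exists (ltnW N1).
have chiN x : ('chi_i x) ^+ N = 1.
  by rewrite -lin_charX ?inE// -(lin_char1 lin); congr ('chi_i _); exact: tors.
pose f x : 'Z_N := (sval (prim_rootP prz (chiN x)))%:R.
have fE x : 'chi_i x = z ^+ f x.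
  by rewrite /f; case: (prim_rootP _ _) => k /= ->; rewrite val_Zp_nat// modn_small.
have fD x y : f (x + y) = f x + f y.
  have /eqP : z ^+ f (x + y) = z ^+ (f x + f y)%N.
    by rewrite exprD -!fE -lin_charM ?inE.
  rewrite (eq_prim_root_expr prz) modn_small; last first.
    by rewrite -[X in (_ < X)%N](Zp_cast N1) ltn_ord.
  have modN m : (m %% (Zp_trunc N).+2 = m %% N)%N by rewrite Zp_cast.
  by move=> /eqP fxy; apply/val_inj; rewrite /= fxy modN.
have fP : [ffun x => f x] \in @is_char N A.
  by apply/forallP => x; apply/forallP => y; rewrite !ffunE fD.
exists (Dual fP); rewrite /= ffunE; apply: contra ai => /eqP fa0.
by rewrite cfkerEirr inE (lin_char1 lin) fE fa0.
Qed.

Section additive_character.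
Variables (C : numClosedFieldType) (N : nat).
Hypothesis N1 : (1 < N)%N.

Lemma prim_root_exists : exists z : C, N.-primitive_root z.
Proof.
have N0 : (0 < N)%N by apply: ltnW.
pose p : {poly C} := 'X^N - 1; have [r Dp] := closed_field_poly_normal p.
rewrite (monicP _) ?monicXnsubC // scale1r in Dp.
have rn1 : all N.-unity_root r by apply/allP => z; rewrite -root_prod_XsubC -Dp.
have sz_r : (N < (size r).+1)%N.
  by rewrite -(size_prod_XsubC r id) -Dp size_XnsubC.
have [|z] := hasP (cyclic.has_prim_root N0 rn1 _ sz_r); last by exists z.
by rewrite -separable_prod_XsubC -Dp separable_Xn_sub_1// pnatr_eq0 -lt0n.
Qed.

Definition zchar (k : 'Z_N) : C := xchoose prim_root_exists ^+ k.

Let zP := xchooseP prim_root_exists.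

Lemma zcharD k l : zchar (k + l) = zchar k * zchar l.
Proof.
rewrite /zchar -exprD /=; apply/eqP.
have modN m : (m %% (Zp_trunc N).+2 = m %% N)%N by rewrite Zp_cast.
by rewrite (eq_prim_root_expr zP) modN modn_mod.
Qed.

Lemma zchar0 : zchar 0 = 1. Proof. by []. Qed.

Lemma zchar_eq1 k : (zchar k == 1) = (k == 0).
Proof.
rewrite -[1](expr0 (xchoose prim_root_exists)) (eq_prim_root_expr zP) mod0n.
by rewrite modn_small// -[X in (_ < X)%N](Zp_cast N1) ltn_ord.
Qed.

Lemma zchar_norm k : `|zchar k| = 1.
Proof.
apply/eqP; rewrite -(@pexpr_eq1 _ _ N)//; last exact: ltnW.
by rewrite -normrX -exprM mulnC exprM (prim_expr_order zP) expr1n normr1.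
Qed.

Lemma zchar_neq0 k : zchar k != 0.
Proof. by rewrite -normr_eq0 zchar_norm oner_eq0. Qed.

Lemma zcharN k : zchar (- k) = (zchar k)^*.
Proof.
apply: (mulfI (zchar_neq0 k)).
by rewrite -zcharD subrr zchar0 -normCK zchar_norm expr1n.
Qed.

Lemma zchar_sum (I : Type) (s : seq I) (P : pred I) (F : I -> 'Z_N) :
  zchar (\sum_(i <- s | P i) F i) = \prod_(i <- s | P i) zchar (F i).
Proof. exact: (big_morph zchar zcharD zchar0). Qed.

End additive_character.

Section orthogonality.
Variables (N : nat) (A : finZmodType).
Hypothesis N1 : (1 < N)%N.

Lemma sum_zchar_dual (C : numClosedFieldType) (c : dual N A) :
  \sum_a zchar C N1 (c a) = if c == 0 then #|A|%:R else 0.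
Proof.
case: eqVneq => [->|c0].
  rewrite (eq_bigr (fun=> 1)) ?sumr_const// => a _.
  by rewrite dual_zeroE zchar0.
have [a ca] : exists a, c a != 0.
  apply/existsP; apply: contraNT c0; rewrite negb_exists => /forallP c0.
  by apply/eqP/dual_eq => a; rewrite dual_zeroE; apply/eqP; have := c0 a; rewrite negbK.
set S := \sum_a _; have : (zchar C N1 (c a) - 1) * S = 0.
  rewrite mulrBl mul1r {1}/S mulr_sumr [X in _ - X](reindex_inj (addrI a)) /=.
  by apply/eqP; rewrite subr_eq0; apply/eqP; apply: eq_bigr => b _; rewrite dualD zcharD.
by move=> /eqP; rewrite mulf_eq0 subr_eq0 zchar_eq1 (negPf ca) => /eqP.
Qed.

Hypothesis tors : forall a : A, a *+ N = 0.

Let sum_dual (C : numClosedFieldType) (a : A) :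
  \sum_(c : dual N A) zchar C N1 (c a) = if a == 0 then #|dual N A|%:R else 0.
Proof.
case: eqVneq => [->|a0].
  rewrite (eq_bigr (fun=> 1)) ?sumr_const// => c _.
  by rewrite dual0 zchar0.
have [c ca] := dual_separates N1 tors a0.
set S := \sum_c _; have : (zchar C N1 (c a) - 1) * S = 0.
  rewrite mulrBl mul1r {1}/S mulr_sumr [X in _ - X](reindex_inj (addrI c)) /=.
  by apply/eqP; rewrite subr_eq0; apply/eqP; apply: eq_bigr => b _; rewrite dual_addE zcharD.
by move=> /eqP; rewrite mulf_eq0 subr_eq0 zchar_eq1 (negPf ca) => /eqP.
Qed.

Lemma card_dual : #|dual N A| = #|A|.
Proof.
apply/eqP; rewrite -(eqr_nat algC); apply/eqP.
transitivity (\sum_(a : A) \sum_(c : dual N A) zchar algC N1 (c a)).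
  rewrite (bigD1 0)//= sum_dual eqxx big1 ?addr0// => a /negPf a0.
  by rewrite sum_dual a0.
rewrite exchange_big (bigD1 0)// sum_zchar_dual eqxx big1 => [|c /negPf c0].
  exact: addr0.
by rewrite sum_zchar_dual c0.
Qed.

Lemma sum_dual_zchar (C : numClosedFieldType) (a : A) :
  \sum_(c : dual N A) zchar C N1 (c a) = if a == 0 then #|A|%:R else 0.
Proof. by rewrite sum_dual card_dual. Qed.

End orthogonality.

Definition clique (X : finType) (e : rel X) (H : {set X}) : bool :=
  [forall x in H, forall y in H, e x y].

Lemma cliqueP (X : finType) (e : rel X) (H : {set X}) :
  reflect {in H &, forall x y, e x y} (clique e H).
Proof.
apply: (iffP forall_inP) => [cH x y xH yH|cH x xH].
  exact: (forall_inP (cH x xH)).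
by apply/forall_inP => y yH; apply: cH.
Qed.

(** * Cliques for the evaluation form on [dual N G * G] *)

Section cliques.
Variables (N : nat) (G : finZmodType).

Definition compat (x y : dual N G * G) : bool := (x.1 - y.1) (x.2 - y.2) == 0.

Lemma compatxx x : compat x x.
Proof. by rewrite /compat !subrr dual0. Qed.

Lemma compat_sym x y : compat x y = compat y x.
Proof. by rewrite /compat -(opprB y.1) -(opprB y.2) dualN dual_oppE opprK. Qed.

(* The polarization of [compat] vanishes on a clique translated to contain 0. *)
Lemma clique_polar (H : {set dual N G * G}) h x y :
  clique compat H -> h \in H -> x \in H -> y \in H ->
  (x.1 - h.1) (y.2 - h.2) + (y.1 - h.1) (x.2 - h.2) = 0.
Proof.
move=> /cliqueP cH hH xH yH.
have /eqP xh := cH _ _ xH hH; have /eqP yh := cH _ _ yH hH.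
have /eqP := cH _ _ xH yH.
rewrite !dual_subE !dualB in xh yh *.
move: (x.1 x.2) (x.1 y.2) (x.1 h.2) (y.1 x.2) (y.1 y.2) (y.1 h.2) (h.1 x.2)
  (h.1 y.2) (h.1 h.2) xh yh => a b c d e f g i j xh yh xy.
have -> : b - c - (i - j) + (d - f - (g - j)) =
  (a - c - (g - j)) + (e - f - (i - j)) - (a - b - (d - e)) by ring.
by rewrite xh yh xy addr0 subrr.
Qed.

Hypothesis N1 : (1 < N)%N.
Hypothesis tors : forall a : G, a *+ N = 0.

Let phi (x z : dual N G * G) : algC := zchar algC N1 (x.1 z.2 + z.1 x.2).

Let phi_sum x : \sum_z phi x z = if x == 0 then #|G|%:R ^+ 2 else 0.
Proof.
transitivity (\sum_c \sum_a phi x (c, a)).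
  by rewrite pair_big /=; apply: eq_bigr => -[].
rewrite /phi /=; under eq_bigr => c _.
  under eq_bigr => a _ do rewrite zcharD mulrC.
  rewrite -mulr_sumr sum_zchar_dual; over.
rewrite -mulr_suml (sum_dual_zchar N1 tors).
case: x => c a /=; rewrite -[(c, a) == 0]/((c == 0) && (a == 0)).
by case: (c == 0); case: (a == 0); rewrite ?(mulr0, mul0r).
Qed.

Let phiB x y z : phi (x - y) z = phi x z * (phi y z)^*.
Proof.
rewrite /phi -zcharN -zcharD /=; congr zchar.
by rewrite dual_subE dualB /=; ring.
Qed.

(* Parseval for the nondegenerate polarization, tested on the clique itself. *)
Lemma clique_card H : clique compat H -> (#|H| <= #|G|)%N.
Proof.
move=> cH; have [->|/set0Pn[h hH]] := eqVneq H finset.set0; first by rewrite cards0.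
pose S z := \sum_(x in H) phi (x - h) z.
have parseval : \sum_z `|S z| ^+ 2 = #|H|%:R * #|G|%:R ^+ 2.
  transitivity (\sum_(x in H) \sum_(y in H) \sum_z phi (x - y) z).
    rewrite [RHS](eq_bigr _ (fun x _ => exchange_big _ _ _ _ _ _)) /=.
    rewrite exchange_big /=; apply: eq_bigr => z _.
    rewrite normCK /S mulr_suml; apply: eq_bigr => x _.
    rewrite rmorph_sum mulr_sumr; apply: eq_bigr => y _.
    by rewrite -phiB opprB addrA subrK.
  rewrite (eq_bigr (fun=> #|G|%:R ^+ 2)); first by rewrite sumr_const mulr_natl.
  move=> x xH; rewrite (bigD1 x)//= phi_sum subrr eqxx big1 ?addr0// => y /andP[_].
  by rewrite phi_sum subr_eq0 eq_sym => /negPf->.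
have : #|H|%:R * #|H|%:R ^+ 2 <= #|H|%:R * #|G|%:R ^+ 2 :> algC.
  rewrite -parseval (reindex_inj (addIr (- h))) /= (bigID [in H])/=.
  rewrite -[leLHS]addr0 lerD ?sumr_ge0//.
  rewrite mulr_natl -sumr_const ler_sum// => z zH.
  suff -> : S (z - h) = #|H|%:R by rewrite normr_nat.
  rewrite /S -sumr_const; apply: eq_bigr => x xH.
  by rewrite /phi (clique_polar cH hH xH zH) zchar0.
rewrite ler_pM2l ?ltr0n; last by apply/card_gt0P; exists h.
by rewrite ler_pXn2r ?nnegrE ?ler0n// ler_nat.
Qed.

(* x and x' below differ by (c - c', 0), whose polarization against the clique
   only sees c - c' on differences of second coordinates. *)
Lemma max_clique_graph H : clique compat H -> #|H| = #|G| ->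
  (forall c : dual N G, {in H &, forall x y, c (x.2 - y.2) = 0} -> c = 0) ->
  exists2 a : {ffun G -> dual N G},
    forall g h, compat (a g, g) (a h, h) & H = [set (a g, g) | g : G].
Proof.
move=> cH cardH gen.
have inj : {in H &, injective (snd : dual N G * G -> G)}.
  move=> x x' xH x'H xx'; rewrite [x]surjective_pairing [x']surjective_pairing xx'.
  congr (_, _); apply/eqP; rewrite -subr_eq0; apply/eqP/gen => y z yH zH.
  have := clique_polar cH zH xH yH; rewrite xx' => P1.
  have := clique_polar cH zH x'H yH => P2.
  have -> : x.1 - x'.1 = (x.1 - z.1) - (x'.1 - z.1) by rewrite opprB addrA subrK.
  apply/eqP; rewrite dual_subE subr_eq0; apply/eqP.
  by apply: (addIr ((y.1 - z.1) (x'.2 - z.2))); rewrite P1 P2.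
have im : snd @: H = [set: G].
  by apply/eqP; rewrite eqEcard finset.subsetT cardsT card_in_imset// cardH leqnn.
have pre g : exists x, (x \in H) && (x.2 == g).
  have : g \in snd @: H by rewrite im inE.
  by case/imsetP => x xH ->; exists x; rewrite xH eqxx.
pose a := [ffun g => (xchoose (pre g)).1].
have aH g : (a g, g) \in H.
  have /andP[xH /eqP xg] := xchooseP (pre g).
  by rewrite /a ffunE -[X in (_, X)]xg -surjective_pairing.
exists a; first by move=> g h; apply: (cliqueP _ _ cH).
apply/setP => x; apply/idP/imsetP => [xH|[g _ ->]//].
by exists x.2 => //; apply: inj.
Qed.

End cliques.
Arguments compat {N G} x y.

(** * Concentration on maximal cliques *)

Section concentration.
Variables (R : realType) (X : finType) (e : rel X).

Definition vimage n (v : {ffun 'I_n -> X}) : {set X} := [set v i | i : 'I_n]%SET.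

Definition edefect n (v : {ffun 'I_n -> X}) : nat :=
  #|[set p : 'I_n * 'I_n | ~~ e (v p.1) (v p.2)]%SET|.

Definition multiplicity n (v : {ffun 'I_n -> X}) (x : X) : nat :=
  #|[set i | v i == x]%SET|.

Definition outside n (H : {set X}) (v : {ffun 'I_n -> X}) : nat :=
  #|[set i | v i \notin H]%SET|.

Lemma edefect_ge n (v : {ffun 'I_n -> X}) (B : {set 'I_n}) (m : R) :
  (forall i, i \in B -> exists2 y, ~~ e (v i) y & m <= (multiplicity v y)%:R) ->
  #|B|%:R * m <= (edefect v)%:R.
Proof.
move=> By; have -> : edefect v = (\sum_i #|[set j | ~~ e (v i) (v j)]%SET|)%N.
  under eq_bigr => i _ do rewrite -sum1dep_card.
  by rewrite /edefect pair_big_dep -sum1dep_card; apply: eq_bigl => -[].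
rewrite natr_sum (bigID [in B])/= -[leLHS]addr0 lerD ?sumr_ge0//.
rewrite mulr_natl -sumr_const ler_sum// => i /By[y ey /le_trans]; apply.
rewrite ler_nat; apply/subset_leq_card/fintype.subsetP => j.
by rewrite !inE => /eqP->.
Qed.

Lemma outside_le n (H : {set X}) (v : {ffun 'I_n -> X}) (m : R) : 0 <= m ->
  (forall x, x \notin H -> (multiplicity v x)%:R <= m) ->
  (outside H v)%:R <= #|X|%:R * m.
Proof.
move=> m0 Hm; have -> : outside H v = (\sum_(x | x \notin H) multiplicity v x)%N.
  rewrite /outside -sum1dep_card (partition_big v (fun x => x \notin H))//=.
  apply: eq_bigr => x xH; rewrite /multiplicity -sum1dep_card.
  by apply: eq_bigl => i; case: eqP => [->|]; rewrite ?xH ?andbF.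
rewrite natr_sum mulr_natl -sumr_const [leRHS](bigID (fun x => x \notin H))/=.
by rewrite -[leLHS]addr0 lerD ?sumr_ge0// ler_sum.
Qed.

Lemma sum_outside n (H : {set X}) (t : R) :
  \sum_(v : {ffun 'I_n -> X}) expR (- t * (outside H v)%:R) <=
  (#|H|%:R + #|X|%:R * expR (- t)) ^+ n.
Proof.
pose f x := if x \in H then 1 else expR (- t).
rewrite (eq_bigr (fun v : {ffun 'I_n -> X} => \prod_i f (v i))); last first.
  move=> v _; rewrite expRM_natr /outside cardsE -prodr_const.
  rewrite big_mkcond; apply: eq_bigr => i _; rewrite /f.
  by rewrite -[i \in _]/(v i \notin H); case: (v i \in H).
rewrite -(bigA_distr_bigA (fun (_ : 'I_n) x => f x)) /=.
rewrite prodr_const card_ord; apply: lerXn2r; rewrite ?nnegrE.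
- by apply: sumr_ge0 => x _; rewrite /f; case: ifP => // _; exact: expR_ge0.
- by rewrite addr_ge0// mulr_ge0// expR_ge0.
rewrite /f (bigID [in H])/= lerD//.
  by rewrite -sumr_const ler_sum// => x ->.
rewrite mulr_natl -sumr_const [leRHS](bigID [in H])/= addrC -[leLHS]addr0.
rewrite lerD ?sumr_ge0//.
by apply: ler_sum => x /negPf->.
Qed.

Hypotheses (exx : reflexive e) (e_sym : symmetric e).
Variables (k : nat) (r : R).
Hypotheses (k0 : (0 < k)%N) (r0 : 0 <= r) (r1 : r < 1).
Hypothesis clique_le : forall H, clique e H -> (#|H| <= k)%N.

Lemma edefect_pointwise (l eps t : R) n (v : {ffun 'I_n -> X}) : (0 < n)%N ->
  0 < l -> r <= expR (- l) -> 0 < eps -> 0 < t ->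
  ~~ (clique e (vimage v) && (#|vimage v| == k)) ->
  r ^+ edefect v <= expR (- l * (eps * n%:R) ^+ 2) +
    (\sum_(H : {set X} | (#|H| < k)%N)
       expR (t * (#|X|%:R * (eps * n%:R))) * expR (- t * (outside H v)%:R) +
     \sum_(H : {set X} | #|H| == k)
       expR (- (l * eps / 2 * n%:R)) *
         expR (- (l * eps / 2 * n%:R) * (outside H v)%:R)).
Proof.
move=> n0 l0 rl eps0 t0 bad.
have n0R : 0 < n%:R :> R by rewrite ltr0n.
have epsn : 0 < eps * n%:R by rewrite mulr_gt0.
have rexp m : r ^+ m <= expR (- l * m%:R).
  by rewrite expRM_natr; apply: lerXn2r; rewrite ?nnegrE ?expR_ge0.
have sum0 (P : pred {set X}) (F : {set X} -> R) :
    (forall H, 0 <= F H) -> 0 <= \sum_(H | P H) F H.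
  by move=> F0; apply: sumr_ge0.
have E0 x y : 0 <= expR x * expR y :> R by rewrite mulr_ge0// expR_ge0.
pose H := [set x | eps * n%:R <= (multiplicity v x)%:R]%SET.
have [cH|] := boolP (clique e H); last first.
  move=> /forall_inPn[x xH /forall_inPn[y yH exy]].
  rewrite -[leLHS]addr0 lerD ?addr_ge0 ?sum0//.
  apply: (le_trans (rexp _)); rewrite ler_expR !mulNr lerN2 ler_wpM2l ?(ltW l0)//.
  rewrite !inE in xH yH; apply: le_trans (_ : (multiplicity v x)%:R * (eps * n%:R) <= _).
    by rewrite expr2 ler_wpM2r// ltW.
  by apply: edefect_ge => i; rewrite inE => /eqP->; exists y.
rewrite -[leLHS]add0r lerD ?expR_ge0//.
have := clique_le cH; rewrite leq_eqVlt => /orP[/eqP Hk|Hk].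
  rewrite -[leLHS]add0r lerD ?sum0//.
  rewrite (bigD1 H)/= ?Hk// -[leLHS]addr0 lerD ?sum0//.
  have out0 : (0 < outside H v)%N.
    rewrite card_gt0; apply: contraNneq bad => out0.
    suff -> : vimage v = H by rewrite cH Hk eqxx.
    apply/setP => x; apply/imsetP/idP => [[i _ ->]|].
      by apply: contraT => vi; have /setP/(_ i) := out0; rewrite [LHS]inE vi inE.
    rewrite inE => /(lt_le_trans epsn); rewrite ltr0n => /card_gt0P[j].
    by rewrite inE => /eqP<-; exists j.
  apply: (le_trans (rexp _)); rewrite -expRD ler_expR.
  have ed : (outside H v)%:R * (eps * n%:R) <= (edefect v)%:R.
    apply: edefect_ge => i; rewrite inE => vi.
    have : ~~ clique e (v i |: H)%SET.
      apply/negP => /clique_le; rewrite cardsU1 vi Hk.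
      by rewrite add1n ltnn.
    move=> /forall_inPn[x + /forall_inPn[y + exy]].
    rewrite !finset.in_setU1 => /predU1P[xv|xH] /predU1P[yv|yH].
    - by rewrite xv yv exx in exy.
    - by exists y; rewrite -?xv//; move: yH; rewrite inE.
    - by exists x; [rewrite -yv e_sym|move: xH; rewrite inE].
    - by rewrite (cliqueP _ _ cH) in exy.
  have out1 : 1 <= (outside H v)%:R :> R by rewrite ler1n.
  rewrite -mulNr; set p := (outside H v)%:R in ed out1 *; set q := (edefect v)%:R in ed *.
  set z := eps * n%:R in ed epsn.
  have -> : - (l * eps / 2) * n%:R + - (l * eps / 2) * n%:R * p = - (l * (z * (1 + p) / 2)).
    by rewrite /z; field.
  rewrite mulNr lerN2 ler_pM2l//; apply: le_trans ed.
  by nra.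
rewrite -[leLHS]addr0 lerD ?sum0//.
rewrite (bigD1 H)/= ?Hk// -[leLHS]addr0 lerD ?sum0//.
apply: (@le_trans _ _ 1); first by rewrite exprn_ile1// ltW.
rewrite -expRD -[leLHS]expR0 ler_expR mulNr -mulrBr mulr_ge0 ?(ltW t0)// subr_ge0.
apply: outside_le; first exact: ltW.
by move=> x; rewrite inE -ltNge => /ltW.
Qed.

Lemma quadratic_le_linear (a b : R) : 0 < b ->
  forall x, a * x - b * x ^+ 2 <= (a + 1) ^+ 2 / (4 * b) - x.
Proof.
move=> b0 x; rewrite -subr_ge0.
have -> : (a + 1) ^+ 2 / (4 * b) - x - (a * x - b * x ^+ 2) =
   b * (x - (a + 1) / (2 * b)) ^+ 2 by field; lra.
by rewrite mulr_ge0 ?sqr_ge0// ltW.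
Qed.

Lemma sum_edefect : exists c K : R, [/\ 0 < c, 0 < K &
  forall n, (0 < n)%N ->
    \sum_(v : {ffun 'I_n -> X} | ~~ (clique e (vimage v) && (#|vimage v| == k)))
      r ^+ edefect v <= K * expR (- c * n%:R) * k%:R ^+ n].
Proof.
pose M : R := #|X|%:R + 1.
have M1 : 1 <= M by rewrite lerDr.
have MX : #|X|%:R <= M by rewrite lerDl.
clearbody M.
have k1 : 1 <= k%:R :> R by rewrite ler1n.
pose l := - ln (Num.max r (1 / 2)).
have rmax : 0 < Num.max r (1 / 2) by rewrite lt_max; apply/orP; right; lra.
have l0 : 0 < l.
  by rewrite oppr_gt0 ln_lt0// rmax gt_max r1; lra.
have rl : r <= expR (- l) by rewrite opprK lnK ?posrE// le_max lexx.
pose c0 := - ln (1 - (2 * k%:R)^-1) / 2 : R.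
have kinv : 0 < (2 * k%:R : R)^-1 <= 1 / 2.
  rewrite invr_gt0 mulr_gt0 ?ltr0n//= -[leRHS]invrK lef_pV2 ?posrE; lra.
have c00 : 0 < c0.
  by rewrite divr_gt0// oppr_gt0 ln_lt0//; move: kinv; set z := _^-1; lra.
have ec0 : expR (- (2 * c0)) = 1 - (2 * k%:R)^-1.
  rewrite /c0 mulrC divfK ?pnatr_eq0// opprK lnK// posrE.
  by move: kinv; set z := _^-1; lra.
(* The choice of t turns |H| + M exp(-t) into at most k - 1/2 = k exp(-2 c0) when
   |H| < k, and then eps makes the prefactor exp(t M eps n) equal to exp(c0 n). *)
pose t := ln (2 * M).
have t0 : 0 < t by rewrite ln_gt0//; lra.
have et : M * expR (- t) = 1 / 2.
  by rewrite expRN lnK ?posrE; [field|]; lra.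
pose eps := c0 / (t * M).
have tM : 0 < t * M by rewrite mulr_gt0//; lra.
have eps0 : 0 < eps by rewrite divr_gt0.
pose mu := l * eps / 2.
have mu0 : 0 < mu by rewrite divr_gt0// mulr_gt0.
have b0 : 0 < l * eps ^+ 2 by rewrite mulr_gt0// exprn_gt0.
pose K1 := expR ((ln M + 1) ^+ 2 / (4 * (l * eps ^+ 2))).
pose K2 := #|{set X}|%:R : R.
pose c := Num.min 1 (Num.min c0 mu).
exists c, (K1 + K2 + K2 * expR (M / mu)).
have K20 : 0 <= K2 by rewrite /K2.
split; first by rewrite !lt_min ltr01 c00 mu0.
  by rewrite ltr_wpDr ?mulr_ge0 ?expR_ge0// ltr_wpDr ?expR_gt0.
move=> n n0; have n0R : 0 < n%:R :> R by rewrite ltr0n.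
have cle x : c <= x -> expR (- (x * n%:R)) <= expR (- c * n%:R).
  by move=> cx; rewrite ler_expR mulNr lerN2 ler_pM2r.
pose S (v : {ffun 'I_n -> X}) : R := expR (- l * (eps * n%:R) ^+ 2) +
  (\sum_(H : {set X} | (#|H| < k)%N)
     expR (t * (#|X|%:R * (eps * n%:R))) * expR (- t * (outside H v)%:R) +
   \sum_(H : {set X} | #|H| == k)
     expR (- (mu * n%:R)) * expR (- (mu * n%:R) * (outside H v)%:R)).
apply: (@le_trans _ _ (\sum_v S v)).
  rewrite [leRHS](bigID (fun v => ~~ (clique e (vimage v) && (#|vimage v| == k))))/=.
  rewrite -[leLHS]addr0 lerD ?ler_sum// => [v bad|].
    exact: (edefect_pointwise n0 l0 rl eps0 t0 bad).
  rewrite sumr_ge0// => v _.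
  by rewrite !addr_ge0 ?expR_ge0//; apply: sumr_ge0 => H _;
    rewrite mulr_ge0 ?expR_ge0.
rewrite !big_split /= !mulrDl -addrA.
have kn0 : 0 < k%:R ^+ n :> R by rewrite exprn_gt0// ltr0n.
have kn1 : 1 <= k%:R ^+ n :> R by rewrite exprn_ege1.
have sumK2 (P : pred {set X}) (F : {set X} -> R) (B : R) : 0 <= B ->
    (forall H, P H -> F H <= B) -> \sum_(H | P H) F H <= K2 * B.
  move=> B0 FB; rewrite /K2 mulr_natl -sumr_const big_mkcond ler_sum// => H _.
  by case: ifP => // /FB.
rewrite lerD//; last rewrite lerD//.
- rewrite sumr_const card_ffun card_ord -[leLHS]mulr_natl.
  apply: (@le_trans _ _ (K1 * expR (- c * n%:R))); last first.
    by rewrite ler_peMr// mulr_ge0// expR_ge0.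
  apply: (@le_trans _ _ (K1 * expR (- (1 * n%:R)))); last first.
    by rewrite ler_pM2l ?expR_gt0//; apply: cle; rewrite ge_min lexx.
  rewrite natrX.
  apply: (@le_trans _ _ (M ^+ n * expR (- l * (eps * n%:R) ^+ 2))).
    by rewrite ler_wpM2r ?expR_ge0// lerXn2r ?nnegrE//; lra.
  rewrite -[M]lnK ?posrE; last lra.
  rewrite -expRM_natr /K1 -!expRD ler_expR mul1r.
  have := quadratic_le_linear (ln M) b0 n%:R.
  by rewrite [(eps * _) ^+ 2]exprMn; lra.
- rewrite exchange_big /= -mulrA; apply: sumK2.
    by rewrite mulr_ge0 ?expR_ge0// ltW.
  move=> H Hk; rewrite -mulr_sumr.
  have -> : t * (#|X|%:R * (eps * n%:R)) = c0 * n%:R * (#|X|%:R / M).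
    by rewrite /eps; field; apply/andP; split; lra.
  have XM : #|X|%:R / M <= 1 by rewrite ler_pdivrMr; lra.
  apply: (@le_trans _ _ (expR (c0 * n%:R) * (k%:R * expR (- (2 * c0))) ^+ n)).
    apply: ler_pM; rewrite ?expR_ge0//.
    + by apply: sumr_ge0 => v _; exact: expR_ge0.
    + by rewrite ler_expR ler_piMr// mulr_ge0// ltW.
    + apply: (le_trans (sum_outside _ _ _)); apply: lerXn2r; rewrite ?nnegrE.
      * by rewrite addr_ge0 ?mulr_ge0 ?expR_ge0.
      * by rewrite mulr_ge0 ?expR_ge0.
      * have Hk1 : #|H|%:R + 1 <= k%:R :> R by rewrite natr1 ler_nat.
        have : #|X|%:R * expR (- t) <= 1 / 2.
          by rewrite -et ler_wpM2r ?expR_ge0.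
        have -> : k%:R * expR (- (2 * c0)) = k%:R - 1 / 2.
          by rewrite ec0; field; lra.
        by lra.
  rewrite exprMn -expRM_natr mulrCA [leRHS]mulrC ler_pM2l// -expRD.
  apply: le_trans (cle c0 _); last by rewrite !ge_min lexx orbT.
  by rewrite ler_expR; lra.
- rewrite exchange_big /= -2!mulrA; apply: sumK2.
    by rewrite !mulr_ge0 ?expR_ge0// ltW.
  move=> H /eqP Hk; rewrite -mulr_sumr -/mu.
  apply: (@le_trans _ _ (expR (- c * n%:R) * (k%:R ^+ n * expR (M / mu))));
    last by rewrite mulrA mulrC.
  apply: ler_pM; rewrite ?expR_ge0//.
  + by apply: sumr_ge0 => v _; exact: expR_ge0.
  + by apply: cle; rewrite !ge_min lexx !orbT.
  + apply: (le_trans (sum_outside _ _ _)); rewrite Hk.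
    have emu : n%:R * expR (- (mu * n%:R)) <= mu^-1.
      rewrite expRN ler_pdivrMr ?expR_gt0// mulrC ler_pdivlMr//.
      by apply: le_trans (expR_ge1Dx _); lra.
    apply: (@le_trans _ _ ((k%:R * expR (M * expR (- (mu * n%:R)))) ^+ n)).
      apply: lerXn2r; rewrite ?nnegrE.
      * by rewrite addr_ge0 ?mulr_ge0 ?expR_ge0.
      * by rewrite mulr_ge0 ?expR_ge0.
      * set s := expR (- _).
        have s0 : 0 <= s by exact: expR_ge0.
        apply: (@le_trans _ _ (k%:R * (1 + M * s))).
          rewrite mulrDr mulr1 lerD2l; apply: (@le_trans _ _ (M * s)).
            by rewrite ler_wpM2r.
          by rewrite ler_peMl// mulr_ge0//; lra.
        by rewrite ler_wpM2l// expR_ge1Dx.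
    rewrite exprMn -expRM_natr ler_pM2l// ler_expR -mulrA.
    by rewrite ler_pM2l; [rewrite mulrC|lra].
Qed.

End concentration.

Local Open Scope classical_set_scope.
Local Open Scope ring_scope.

(** * The exterior square *)

Section quotient_lift.
Variables (V B : zmodType) (I : zmodClosed V) (F : {additive V -> B}).
Hypothesis FI : forall x, x \in I -> F x = 0.

Definition quot_lift (q : Quotient.quot I) : B := F (repr q).

Lemma quot_liftE x : quot_lift (\pi_(Quotient.quot I)%qT x) = F x.
Proof.
apply/eqP; rewrite -subr_eq0 -raddfB; apply/eqP/FI.
by rewrite Quotient.idealrBE reprK.
Qed.

Lemma quot_lift_zmod_morphism : zmod_morphism quot_lift.
Proof.
move=> p q; rewrite -[p]reprK -[q]reprK.
by rewrite -[_ - _](raddfB (\pi_(Quotient.quot I)%qT)) !quot_liftE raddfB.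
Qed.

End quotient_lift.

Lemma zgen_kernel (V B : zmodType) (A : set V) (F : {additive V -> B}) :
  (forall x, A x -> F x = 0) -> forall x, x \in zgen A -> F x = 0.
Proof.
move=> FA x /asboolP xA.
pose K : {pred V} := fun x => F x == 0.
have K0 : zmod_closed K.
  by split=> [|y z /eqP y0 /eqP z0]; apply/eqP; rewrite ?raddf0// raddfB y0 z0 subrr.
pose H : zmodClosed V := HB.pack K (GRing.isZmodClosed.Build V K K0).
by have /eqP := xA H (fun y Ay => introT eqP (FA y Ay)).
Qed.

Lemma finite_zmodType (V : zmodType) : finite_set [set: V] ->
  exists (A : finZmodType) (f : V -> A) (g : A -> V),
    [/\ zmod_morphism f, cancel f g, cancel g f & #|A| = ncard [set: V]].
Proof.
move=> fin; pose s : seq V := fset_set [set: V].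
have sP x : x \in s by rewrite in_fset_set// in_setT.
have us : uniq s by exact: fset_uniq.
have ax : Finite.axiom s by move=> x; rewrite count_uniq_mem// sP.
have cK : cancel (index^~ s) (nth 0 s) by move=> x; rewrite nth_index.
pose A : finZmodType := HB.pack (GRing.Zmodule.sort V)
  (Countable.copy (GRing.Zmodule.sort V) (can_type cK))
  (fintype.isFinite.Build (GRing.Zmodule.sort V) ax).
exists A, id, id; split=> //.
rewrite /ncard -[RHS](fintype.card_uniqP (us : @uniq A s)).
by apply: eq_card => x; rewrite [RHS]sP.
Qed.

Section exterior_square.
Variable G : finZmodType.

Let ptens (h : {ffun G * G -> int}) : tensor G G :=
  \pi_(Quotient.quot (zgen (bilinear_relations G G)))%qT h.

Let pext (t : tensor G G) : ext2 G :=
  \pi_(Quotient.quot (zgen [set tens g g | g in [set: G]]))%qT t.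

Definition wedge (a b : G) : ext2 G := pext (tens a b).

Lemma wedgeDl a a' b : wedge (a + a') b = wedge a b + wedge a' b.
Proof.
have : tensor_gen (a + a') b - tensor_gen a b - tensor_gen a' b
    \in zgen (bilinear_relations G G).
  by apply: sub_zgen; left; exists a, a', b.
rewrite -addrA -opprD Quotient.idealrBE => /eqP E.
rewrite /wedge /tens E -[RHS](raddfD (\pi_(Quotient.quot _)%qT)).
by congr pext; exact: raddfD.
Qed.

Lemma wedgeDr a b b' : wedge a (b + b') = wedge a b + wedge a b'.
Proof.
have : tensor_gen a (b + b') - tensor_gen a b - tensor_gen a b'
    \in zgen (bilinear_relations G G).
  by apply: sub_zgen; right; exists a, b, b'.
rewrite -addrA -opprD Quotient.idealrBE => /eqP E.
rewrite /wedge /tens E -[RHS](raddfD (\pi_(Quotient.quot _)%qT)).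
by congr pext; exact: raddfD.
Qed.

Lemma wedgexx a : wedge a a = 0.
Proof.
have : tens a a - 0 \in zgen [set tens g g | g in [set: G]].
  by rewrite subr0; apply: sub_zgen; exists a.
by rewrite Quotient.idealrBE => /eqP E; rewrite /wedge /pext E; exact: raddf0.
Qed.

Lemma ffun_int_sum (h : {ffun G * G -> int}) :
  h = \sum_p tensor_gen p.1 p.2 *~ h p.
Proof.
have ffunMzE (f : {ffun G * G -> int}) k y : (f *~ k) y = f y *~ k.
  by case: k => k; rewrite ?NegzE ?mulrNz ?ffunE -!pmulrn ffunMnE.
apply/ffunP => y; rewrite sum_ffunE (bigD1 y)//= big1 ?addr0.
  by rewrite ffunMzE !ffunE -surjective_pairing eqxx/= intz.
move=> x xy; rewrite ffunMzE !ffunE -surjective_pairing.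
by rewrite eq_sym (negPf xy) mul0rz.
Qed.

Lemma wedge_span (x : ext2 G) :
  exists h : G * G -> int, x = \sum_p wedge p.1 p.2 *~ h p.
Proof.
exists (repr (repr x)); rewrite -[LHS]reprK -[repr x in LHS]reprK.
set h := repr (repr x); rewrite {1}[h]ffun_int_sum.
rewrite -[\pi_(tensor G G)%qT _]/(ptens _) /ptens raddf_sum.
rewrite [LHS]raddf_sum; apply: eq_bigr => p _.
by rewrite raddfMz [LHS]raddfMz.
Qed.

Lemma wedge_lift (B : zmodType) (b : G -> G -> B) :
  (forall g g' h, b (g + g') h = b g h + b g' h) ->
  (forall g h h', b g (h + h') = b g h + b g h') ->
  (forall g, b g g = 0) ->
  exists2 f : ext2 G -> B, zmod_morphism f & forall g h, f (wedge g h) = b g h.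
Proof.
move=> bDl bDr bxx.
pose F0 (h : {ffun G * G -> int}) := \sum_p b p.1 p.2 *~ h p.
have F0m : zmod_morphism F0.
  move=> h h'; rewrite /F0 -sumrB; apply: eq_bigr => p _.
  by rewrite !ffunE mulrzBr.
pose F : {additive {ffun G * G -> int} -> B} :=
  HB.pack F0 (GRing.isZmodMorphism.Build _ _ F0 F0m).
have Fgen g h : F (tensor_gen g h) = b g h.
  rewrite [LHS]/(F0 _) /F0 (bigD1 (g, h))//= big1 ?addr0 ?ffunE ?eqxx//.
  by move=> p /negPf pgh; rewrite ffunE pgh.
have FI x : x \in zgen (bilinear_relations G G) -> F x = 0.
  apply: zgen_kernel => {}x -[[a [a' [c ->]]]|[a [c [c' ->]]]].
    by rewrite !raddfB !Fgen bDl addrAC addrK subrr.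
  by rewrite !raddfB !Fgen bDr addrAC addrK subrr.
pose F' : {additive tensor G G -> B} :=
  HB.pack (quot_lift F) (GRing.isZmodMorphism.Build _ _ _ (quot_lift_zmod_morphism FI)).
have FI' x : x \in zgen [set tens g g | g in [set: G]] -> F' x = 0.
  by apply: zgen_kernel => {}x [g _ <-]; rewrite [LHS]quot_liftE// Fgen bxx.
exists (quot_lift F'); first exact: quot_lift_zmod_morphism.
by move=> g h; rewrite quot_liftE// [LHS]quot_liftE// Fgen.
Qed.

End exterior_square.

Section clique_functions.
Variables (N : nat) (G : finZmodType).
Hypothesis N1 : (1 < N)%N.
Hypothesis tors : forall a : G, a *+ N = 0.

Definition clique_fun (a : {ffun G -> dual N G}) : bool :=
  [forall g, forall h, compat (a g, g) (a h, h)].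

Lemma clique_funP (a : {ffun G -> dual N G}) :
  reflect (forall g h, (a g - a h) (g - h) = 0) (clique_fun a).
Proof.
apply: (iffP forallP) => [c g h|c g].
  by have /forallP/(_ h)/eqP := c g.
by apply/forallP => h; rewrite /compat c.
Qed.

Lemma card_clique_fun :
  #|[set a | clique_fun a]%SET| = (#|G| * ncard [set: ext2 G])%N.
Proof.
have [A [f [f' [fB fK f'K <-]]]] := finite_zmodType (finite_ext2 G).
pose F : {additive ext2 G -> A} := HB.pack f (GRing.isZmodMorphism.Build _ _ f fB).
have wedge0 h : wedge 0 h = 0 :> ext2 G.
  by apply: (addrI (wedge 0 h)); rewrite -wedgeDl !addr0.
have wedgeMn g h m : wedge (g *+ m) h = wedge g h *+ m :> ext2 G.
  by elim: m => [|m IH]; rewrite ?mulr0n// !mulrS wedgeDl IH.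
have torsA (x : A) : x *+ N = 0.
  rewrite -(f'K x) -[f _ *+ N](raddfMn F); have [h ->] := wedge_span (f' x).
  rewrite -sumrMnl big1 ?raddf0// => p _.
  by rewrite pmulrn mulrzAC -pmulrn -wedgeMn tors wedge0 mul0rz.
rewrite -(card_dual N1 tors) -(card_dual N1 torsA) -card_prod.
pose psi_ffun (phi : dual N A) g := [ffun h => phi (F (wedge g h))] : {ffun G -> 'Z_N}.
have psiP phi g : psi_ffun phi g \in @is_char N G.
  apply/forallP => h; apply/forallP => h'.
  by rewrite !ffunE wedgeDr raddfD dualD.
pose psi phi g := Dual (psiP phi g).
have psiE phi g h : psi phi g h = phi (F (wedge g h)) by rewrite ffunE.
have psi0 phi : psi phi 0 = 0.
  by apply/dual_eq => h; rewrite psiE wedge0 raddf0 dual0 dual_zeroE.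
pose Phi (x : dual N G * dual N A) := [ffun g => x.1 + psi x.2 g].
have PhiE c phi g : Phi (c, phi) g = c + psi phi g by rewrite ffunE.
have Phi_inj : injective Phi.
  move=> [c phi] [c' phi'] /ffunP E.
  have cc' : c = c' by have := E 0; rewrite !PhiE !psi0 !addr0.
  congr (_, _) => //; apply/dual_eq => x; rewrite -(f'K x).
  have [h ->] := wedge_span (f' x).
  rewrite -[f _]/(F _) raddf_sum !dual_sum; apply: eq_bigr => p _.
  rewrite raddfMz !dualMz; congr (_ *~ _).
  have := E p.1; rewrite !PhiE cc' => /addrI /(congr1 (fun c : dual N G => c p.2)).
  by rewrite !psiE.
rewrite -(card_codom Phi_inj); apply: eq_card => a; rewrite inE.
apply/clique_funP/codomP => [aP|[[c phi] -> g h]]; last first.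
  rewrite !PhiE opprD addrACA subrr add0r dual_subE !dualB !psiE !wedgexx.
  rewrite raddf0 dual0 sub0r subr0 -opprD -dualD -raddfD.
  have -> : wedge g h + wedge h g = 0 :> ext2 G.
    by rewrite -(wedgexx (g + h)) wedgeDl !wedgeDr !wedgexx add0r addr0.
  by rewrite raddf0 dual0 oppr0.
pose b g h := (a g - a 0) h.
have bDr g h h' : b g (h + h') = b g h + b g h' by rewrite /b dualD.
have bxx g : b g g = 0 by have := aP g 0; rewrite subr0.
have bN g h : b g h = - b h g.
  have := aP g h; have -> : a g - a h = (a g - a 0) - (a h - a 0).
    by rewrite opprB addrA subrK.
  rewrite dual_subE !dualB -/(b g g) -/(b g h) -/(b h g) -/(b h h) !bxx.
  by rewrite sub0r subr0 -opprD => /eqP; rewrite oppr_eq0 addr_eq0 => /eqP.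
have bDl g g' h : b (g + g') h = b g h + b g' h.
  by rewrite bN bDr opprD -!bN.
have [u um ub] := wedge_lift bDl bDr bxx.
pose U : {additive ext2 G -> 'Z_N} := HB.pack u (GRing.isZmodMorphism.Build _ _ u um).
have f'D x y : f' (x + y) = f' x + f' y.
  by rewrite -[f' x + f' y]fK -[f _]/(F _) raddfD /= !f'K.
have phiP : [ffun x => U (f' x)] \in @is_char N A.
  by apply/forallP => x; apply/forallP => y; rewrite !ffunE f'D raddfD.
exists (a 0, Dual phiP); apply/ffunP => g; rewrite PhiE; apply/dual_eq => h.
rewrite dual_addE psiE; have -> : Dual phiP (F (wedge g h)) = (a g - a 0) h.
  by rewrite [LHS]ffunE [f' _]fK [LHS]ub.
by rewrite dual_subE addrC subrK.
Qed.

End clique_functions.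

(** * Surjections from the sandpile group *)

Lemma ncard_bij (T : choiceType) (F : finType) (c : T -> F) (A : set T) (B : {set F}) :
  {in A &, injective c} -> (forall x, A x -> c x \in B) ->
  (forall y, y \in B -> exists2 x, A x & c x = y) -> ncard A = #|B|.
Proof.
move=> inj AB BA; have fA := finite_set_code inj.
have memA x : (x \in fset_set A) = (x \in A) by exact: in_fset_set.
rewrite /ncard -(size_map c) -(fintype.card_uniqP _); last first.
  by rewrite map_inj_in_uniq ?fset_uniq// => x y; rewrite !memA; exact: inj.
apply: eq_card => y; apply/mapP/idP => [[x + ->]|/BA[x Ax <-]].
  by rewrite memA => /set_mem; exact: AB.
by exists x => //; rewrite memA; exact: mem_set.
Qed.

Section weighted_sum.
Variables (n : nat) (G : finZmodType).
Implicit Type v : {ffun 'I_n -> G}.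

Definition wsum v (z : 'cV[int]_n) : G := \sum_i v i *~ z i 0.

Lemma wsum_zmod_morphism v : zmod_morphism (wsum v).
Proof.
by move=> x y; rewrite /wsum -sumrB; apply: eq_bigr => i _; rewrite !mxE mulrzBr.
Qed.

Lemma wsum0 v : wsum v 0 = 0.
Proof. by rewrite /wsum big1// => i _; rewrite mxE mulr0z. Qed.

Lemma wsum_delta v i j : wsum v (delta_mx i 0 - delta_mx j 0) = v i - v j.
Proof.
have wd k : wsum v (delta_mx k 0) = v k.
  rewrite /wsum (bigD1 k)//= big1 ?addr0 ?mxE ?eqxx// => l /negPf lk.
  by rewrite mxE lk.
by rewrite wsum_zmod_morphism !wd.
Qed.

Lemma wsum_const v t z : z \in @sum_zero n -> wsum [ffun i => t + v i] z = wsum v z.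
Proof.
move=> /eqP z0; rewrite /wsum; under eq_bigr do rewrite ffunE mulrzDl.
by rewrite big_split /= -mulrz_sumr z0 mulr0z add0r.
Qed.

(* [v] is regarded as the homomorphism from the sum-zero vectors to [G] sending
   the difference of the i-th and j-th basis vectors to [v i - v j]. *)
Definition generating v : bool :=
  `[< forall x, exists2 z, z \in @sum_zero n & wsum v z = x >].

Lemma generating_dual N v (c : dual N G) : generating v ->
  (forall i j, c (v i - v j) = 0) -> c = 0.
Proof.
move=> /asboolP gv cv; apply/dual_eq => x; rewrite dual_zeroE.
have [z z0 <-] := gv x.
rewrite dual_sum; case: (pickP 'I_n) => [i0 _|n0]; last first.
  by rewrite big1// => i; have := n0 i.
rewrite (eq_bigr (fun i => c (v i0) *~ z i 0)).
  by rewrite -mulrz_sumr (eqP z0) mulr0z.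
move=> i _; rewrite dualMz; congr (_ *~ _).
by apply/eqP; rewrite -subr_eq0 -dualB cv.
Qed.

Lemma surj_generating v : (forall x, exists i, v i = x) -> generating v.
Proof.
move=> sv; apply/asboolP => x; have [i <-] := sv x; have [j vj] := sv 0.
exists (delta_mx i 0 - delta_mx j 0); first exact: sum_zero_delta.
by rewrite wsum_delta vj subr0.
Qed.

Definition annihilates (g : simple_graph n) v : bool :=
  [forall j, \sum_(i | adj g i j) (v i - v j) == 0].

Lemma wsum_laplacian (g : simple_graph n) v x :
  wsum v (laplacian g *m x) = \sum_j (\sum_(i | adj g i j) (v i - v j)) *~ x j 0.
Proof.
rewrite /wsum; under eq_bigr do rewrite mxE mulrz_sumr.
rewrite exchange_big; apply: eq_bigr => j _ /=.
under eq_bigr do rewrite mulrzA; rewrite -mulrz_suml; congr (_ *~ _).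
rewrite sumrB sumr_const (bigD1 j)//= mxE eqxx mulrNz -pmulrn addrC.
congr (_ - _); last first.
  by rewrite /degree cardsE; congr (_ *+ _); apply: eq_card => i; rewrite [RHS]adjC.
rewrite big_mkcond [RHS]big_mkcond; apply: eq_bigr => i _ /=.
rewrite mxE; case: eqVneq => [->|_]; first by rewrite adjxx.
by case: adj; rewrite ?mulr1z ?mulr0z.
Qed.

End weighted_sum.

Section count_Sur.
Variables (n : nat) (g : simple_graph n.+1) (G : finZmodType).

Let p (z : zsum_zero n.+1) : sandpile g :=
  \pi_(Quotient.quot (laplacian_image g))%qT z.

Let e i : zsum_zero n.+1 := ZSumZero (sum_zero_delta i ord0).

Let base (v : {ffun 'I_n.+1 -> G}) := [&& generating v, annihilates g v & v ord0 == 0].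

Let sum_zeroE (z : zsum_zero n.+1) : z = \sum_i e i *~ val z i 0.
Proof.
apply/val_inj; rewrite raddf_sum.
rewrite (eq_bigr (fun i => val (e i) *~ val z i 0)); last first.
  by move=> i _; rewrite raddfMz.
apply/matrixP => i j; rewrite (ord1 j) summxE.
under eq_bigr => k _ do rewrite -scaler_int !mxE/= !andbT mulrBr intz.
rewrite sumrB -mulr_suml (eqP (zsum_zeroP z)) mul0r subr0.
rewrite (bigD1 i)//= eqxx mulr1 big1 ?addr0// => k /negPf ki.
by rewrite eq_sym ki mulr0.
Qed.

Let code (f : sandpile g -> G) := [ffun i => f (p (e i))].

Let codeE f z : zmod_morphism f -> f (p z) = wsum (code f) (val z).
Proof.
move=> fB; pose F : {additive _ -> _} :=
  HB.pack f (GRing.isZmodMorphism.Build _ _ f fB).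
rewrite -[f _]/(F _) {1}[z]sum_zeroE [p _]raddf_sum raddf_sum.
by apply: eq_bigr => i _; rewrite raddfMz raddfMz ffunE.
Qed.

Let lapl_sum x : ZSumZero (laplacian_sum_zero g x) \in laplacian_image g.
Proof. by apply/asboolP; exists x. Qed.

Lemma ncard_Sur_base : ncard (Sur (sandpile g) G) = #|[set v | base v]%SET|.
Proof.
apply: (@ncard_bij _ _ code).
- move=> f f' /set_mem[fB _] /set_mem[f'B _] ff'.
  by apply/funext => q; rewrite -[q]reprK -[\pi_(_)%qT _]/(p _) !codeE// ff'.
- move=> f [fB fS]; rewrite inE; apply/and3P; split.
  + apply/asboolP => x; have [//|q _ <-] := fS x.
    exists (val (repr q)); first exact: zsum_zeroP.
    by rewrite -codeE// /p reprK.
  + apply/forallP => j; pose z := laplacian g *m delta_mx j 0.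
    have : p (ZSumZero (laplacian_sum_zero g (delta_mx j 0))) = p 0.
      by apply/eqP; rewrite -Quotient.idealrBE subr0 lapl_sum.
    move=> /(congr1 f); rewrite !codeE// [val (0 : zsum_zero _)]raddf0 wsum0 /= wsum_laplacian.
    rewrite (bigD1 j)//= mxE eqxx mulr1z [X in _ + X]big1 ?addr0; last first.
      by move=> i /negPf ij; rewrite mxE ij mulr0z.
    by move=> ->.
  + by rewrite ffunE codeE// [val _]subrr wsum0.
- move=> v; rewrite inE => /and3P[/asboolP gv /forallP av /eqP v0].
  have Fm : zmod_morphism (fun z : zsum_zero n.+1 => wsum v (val z)).
    by move=> x y; rewrite -wsum_zmod_morphism raddfB.
  pose F : {additive zsum_zero n.+1 -> G} :=
    HB.pack (fun z : zsum_zero n.+1 => wsum v (val z)) (GRing.isZmodMorphism.Build _ _ _ Fm).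
  have FI z : z \in laplacian_image g -> F z = 0.
    move=> /asboolP[x zx]; transitivity (wsum v (val z)) => //.
    rewrite zx wsum_laplacian big1// => j _.
    by rewrite (eqP (av j)) mul0rz.
  exists (quot_lift F).
    split; first exact: quot_lift_zmod_morphism.
    move=> x _; have [z z0 zx] := gv x; exists (p (ZSumZero z0)) => //.
    by rewrite quot_liftE.
  apply/ffunP => i; rewrite ffunE quot_liftE//.
  by transitivity (wsum v (val (e i))); rewrite //= wsum_delta v0 subr0.
Qed.

Lemma ncard_Sur_mul : (#|G| * ncard (Sur (sandpile g) G))%N =
  #|[set v : {ffun 'I_n.+1 -> G} | generating v && annihilates g v]%SET|.
Proof.
rewrite ncard_Sur_base -[#|G|]cardsT -cardsX.
pose shift (x : G * {ffun 'I_n.+1 -> G}) := [ffun i => x.1 + x.2 i].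
have gen_shift t v : generating (shift (t, v)) = generating v.
  by apply/asboolP/asboolP => gv x; have [z z0 <-] := gv x; exists z => //;
    rewrite wsum_const.
have ann_shift t v : annihilates g (shift (t, v)) = annihilates g v.
  apply: eq_forallb => j; congr (_ == _); apply: eq_bigr => i _.
  by rewrite !ffunE opprD addrACA subrr add0r.
rewrite -(card_in_imset (f := shift)); last first.
  move=> [t v] [t' v'] /setXP[_ +] /setXP[_ +] /ffunP E.
  rewrite !inE => /and3P[_ _ /eqP v0] /and3P[_ _ /eqP v'0].
  have tt : t = t' by have := E ord0; rewrite !ffunE /= v0 v'0 !addr0.
  congr (_, _) => //; apply/ffunP => i.
  by have := E i; rewrite !ffunE /= tt => /addrI.
apply: eq_card => w; rewrite [RHS]inE; apply/imsetP/andP => [[[t v] /setXP[_ +] ->]|[gw aw]].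
  by rewrite inE gen_shift ann_shift => /and3P[].
have wE : w = shift (w ord0, [ffun i => w i - w ord0]).
  by apply/ffunP => i; rewrite !ffunE addrC subrK.
exists (w ord0, [ffun i => w i - w ord0]) => //.
apply/setXP; split; rewrite inE//; apply/and3P; split.
- by rewrite -(gen_shift (w ord0)) -wE.
- by rewrite -(ann_shift (w ord0)) -wE.
- by rewrite ffunE subrr.
Qed.

End count_Sur.

(** * Fourier expansion *)

Section edge_product.
Variables (C : numClosedFieldType) (n : nat) (q : C) (p : simple_graph n -> C).
Hypothesis pE : forall J : {set {set 'I_n}}, J \subset all_edges n ->
  \sum_(g | J \subset edges g) p g = q ^+ #|J|.

(* Only the inclusion probabilities of edge sets enter, once the product over
   pairs is expanded into a sum over sets of pairs. *)
Lemma mean_edge_product (z : 'I_n -> 'I_n -> C) :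
  \sum_g p g * (\prod_(i < n) \prod_(j < n | (i < j)%N)
                  if adj g i j then z i j else 1) =
  \prod_(i < n) \prod_(j < n | (i < j)%N) (1 - q + q * z i j).
Proof.
pose lt (x : 'I_n * 'I_n) := (x.1 < x.2)%N.
pose F g (x : 'I_n * 'I_n) := if lt x && adj g x.1 x.2 then z x.1 x.2 - 1 else 0.
pose W (x : 'I_n * 'I_n) := if lt x then q * (z x.1 x.2 - 1) else 0.
have expand (f : 'I_n * 'I_n -> C) :
    \prod_x (f x + 1) = \sum_(J : {set 'I_n * 'I_n}) \prod_(x in J) f x.
  rewrite bigA_distr; apply: eq_bigr => J _.
  by rewrite [RHS]big_mkcond.
have lhs g : \prod_(i < n) \prod_(j < n | (i < j)%N) (if adj g i j then z i j else 1) =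
    \sum_(J : {set 'I_n * 'I_n}) \prod_(x in J) F g x.
  rewrite -expand pair_big_dep /= big_mkcond; apply: eq_bigr => -[i j] _ /=.
  by rewrite /F /lt /=; case: ltnP => _ /=; case: (adj g i j); rewrite ?subrK ?add0r.
have -> : \prod_(i < n) \prod_(j < n | (i < j)%N) (1 - q + q * z i j) =
    \sum_(J : {set 'I_n * 'I_n}) \prod_(x in J) W x.
  rewrite -expand pair_big_dep /= big_mkcond; apply: eq_bigr => -[i j] _ /=.
  by rewrite /W /lt /=; case: ltnP => _; [ring|rewrite add0r].
under eq_bigr do rewrite lhs mulr_sumr.
rewrite exchange_big; apply: eq_bigr => J _ /=.
have [Jlt|] := boolP [forall x in J, lt x]; last first.
  move=> /forall_inPn[x xJ /negPf nlt].
  rewrite (bigD1 x)//= {1}/W nlt mul0r big1// => g _.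
  by rewrite (bigD1 x)//= {1}/F nlt mul0r mulr0.
have {}Jlt x : x \in J -> (x.1 < x.2)%N by move=> xJ; exact: (forall_inP Jlt).
pose ed (x : 'I_n * 'I_n) : {set 'I_n} := [set x.1; x.2]%SET.
have ed_inj : {in J &, injective ed}.
  move=> [a b] [c d] /Jlt /= ab /Jlt /= cd E.
  have := set21 a b; rewrite -[[set a; b]%SET]/(ed (a, b)) E !inE => /orP[]/eqP ac.
    have := set22 a b; rewrite -[[set a; b]%SET]/(ed (a, b)) E !inE => /orP[]/eqP bd.
      by move: ab; rewrite ac bd /= ltnn.
    by rewrite ac bd.
  have := set21 c d; rewrite -[[set c; d]%SET]/(ed (c, d)) -E !inE => /orP[]/eqP ca.
    by move: cd; rewrite ca ac /= ltnn.
  by move: cd ab; rewrite ca ac /=; lia.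
have sub g : (ed @: J \subset edges g) = [forall x in J, adj g x.1 x.2].
  apply/fintype.subsetP/forall_inP => [sub x xJ|aJ e /imsetP[x xJ ->]]; last exact: aJ.
  by apply: sub; apply: imset_f.
transitivity (\sum_(g | ed @: J \subset edges g) p g * \prod_(x in J) (z x.1 x.2 - 1)).
  rewrite [RHS]big_mkcond; apply: eq_bigr => g _; rewrite sub.
  case: ifPn => [/forall_inP aJ|/forall_inPn[x xJ /negPf na]].
    by congr (_ * _); apply: eq_bigr => x xJ; rewrite /F /lt Jlt// aJ.
  by rewrite (bigD1 x)//= {1}/F na andbF mul0r mulr0.
rewrite -mulr_suml pE; last first.
  apply/fintype.subsetP => e /imsetP[x xJ ->]; rewrite inE cards2.
  by have := Jlt x xJ; rewrite -val_eqE neq_ltn => ->.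
rewrite card_in_imset// -prodr_const -big_split /=.
by apply: eq_bigr => x xJ; rewrite /W /lt Jlt.
Qed.

End edge_product.

Section fourier.
Variables (C : numClosedFieldType) (N : nat) (G : finZmodType) (n : nat).
Hypothesis N1 : (1 < N)%N.
Hypothesis tors : forall a : G, a *+ N = 0.
Local Notation X := (dual N G * G)%type.
Implicit Types (x : {ffun 'I_n -> X}) (v : {ffun 'I_n -> G}).

Definition defect (a b : X) : 'Z_N := (b.1 - a.1) (a.2 - b.2).

Lemma defect_eq0 a b : (defect a b == 0) = compat a b.
Proof. by rewrite /defect compat_sym /compat -[a.2 - b.2]opprB dualN oppr_eq0. Qed.

Definition snds x : {ffun 'I_n -> G} := [ffun i => (x i).2].

Lemma sum_annihilates (P : pred {ffun 'I_n -> G}) (g : simple_graph n) :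
  #|[set v | P v && annihilates g v]%SET|%:R * #|G|%:R ^+ n =
  \sum_(x : {ffun 'I_n -> X} | P (snds x)) \prod_(i < n) \prod_(j < n | (i < j)%N)
    (if adj g i j then zchar C N1 (defect (x i) (x j)) else 1).
Proof.
pose y v j := \sum_(i | adj g i j) (v i - v j).
have ind v : (annihilates g v)%:R * #|G|%:R ^+ n =
    \sum_(c : {ffun 'I_n -> dual N G}) \prod_j zchar C N1 (c j (y v j)).
  rewrite -(bigA_distr_bigA (fun j (c : dual N G) => zchar C N1 (c (y v j)))) /=.
  under eq_bigr do rewrite (sum_dual_zchar N1 tors).
  case: (boolP (annihilates g v)) => [/forallP av|/forallPn[j nj]].
    rewrite mul1r (eq_bigr (fun=> #|G|%:R)) ?prodr_const ?card_ord// => j _.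
    by rewrite av.
  by rewrite mul0r (bigD1 j)//= (negPf nj) mul0r.
rewrite -sum1dep_card natr_sum mulr_suml.
transitivity (\sum_(v | P v) (annihilates g v)%:R * #|G|%:R ^+ n : C).
  rewrite big_mkcondr; apply: eq_bigr => v _.
  by case: (annihilates g v); rewrite ?mul0r.
under eq_bigr do rewrite ind.
rewrite pair_big_dep /=.
pose h (u : {ffun 'I_n -> G} * {ffun 'I_n -> dual N G}) : {ffun 'I_n -> X} :=
  [ffun i => (u.2 i, u.1 i)].
pose h' x : {ffun 'I_n -> G} * {ffun 'I_n -> dual N G} := (snds x, [ffun i => (x i).1]).
rewrite (reindex h'); last first.
  exists h => [x|[v c]] _.
    by apply/ffunP => i; rewrite !ffunE -surjective_pairing.
  by congr (_, _); apply/ffunP => i; rewrite !ffunE.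
apply: eq_big => [x|x _]; first by rewrite andbT.
rewrite -zchar_sum; transitivity (zchar C N1 (\sum_(i < n) \sum_(j < n | (i < j)%N)
   if adj g i j then defect (x i) (x j) else 0)); last first.
  rewrite zchar_sum; apply: eq_bigr => i _; rewrite zchar_sum.
  by apply: eq_bigr => j _; case: (adj g i j).
congr zchar.
pose f i j : 'Z_N := if adj g i j then (x j).1 ((x i).2 - (x j).2) else 0.
transitivity (\sum_i \sum_j f i j).
  rewrite exchange_big; apply: eq_bigr => j _ /=.
  rewrite /y dual_sum big_mkcond; apply: eq_bigr => i _.
  by rewrite !ffunE /f.
have -> : \sum_i \sum_j f i j =
    \sum_(i < n) \sum_(j < n | (i < j)%N) f i j + \sum_(i < n) \sum_(j < n | (j < i)%N) f i j.
  rewrite -big_split; apply: eq_bigr => i _ /=.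
  rewrite (bigID (fun j : 'I_n => (i < j)%N))/=; congr (_ + _).
  rewrite big_mkcond [RHS]big_mkcond; apply: eq_bigr => j _ /=.
  case: ltngtP => // /val_inj ->.
  by rewrite /f adjxx.
rewrite [X in _ + X](exchange_big_dep xpredT)//= -big_split.
apply: eq_bigr => i _; rewrite -big_split; apply: eq_bigr => j ij /=.
rewrite /f adjC; case: (adj g j i); rewrite ?addr0// /defect dual_subE.
by rewrite -[(x j).2 - (x i).2]opprB dualN.
Qed.

End fourier.

Lemma prod_lt_sqr (C : comNzRingType) n (u : 'I_n -> 'I_n -> C) :
  (forall i, u i i = 1) -> (forall i j, u i j = u j i) ->
  (\prod_(i < n) \prod_(j < n | (i < j)%N) u i j) ^+ 2 = \prod_i \prod_j u i j.
Proof.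
move=> uii uC; have -> : \prod_i \prod_j u i j =
    \prod_(i < n) \prod_(j < n | (i < j)%N) u i j *
    \prod_(i < n) \prod_(j < n | (j < i)%N) u i j.
  rewrite -big_split; apply: eq_bigr => i _ /=.
  rewrite (bigID (fun j : 'I_n => (i < j)%N))/=; congr (_ * _).
  rewrite big_mkcond [RHS]big_mkcond; apply: eq_bigr => j _ /=.
  by case: ltngtP => // /val_inj ->; rewrite uii.
rewrite expr2; congr (_ * _); rewrite [RHS](exchange_big_dep xpredT)//=.
by apply: eq_bigr => i _; apply: eq_bigr => j _; rewrite uC.
Qed.

(* Squaring turns the product over pairs i < j into one over ordered pairs. *)
Lemma norm_pair_product (C : numDomainType) (X : finType) (e : rel X)
    (w : X -> X -> C) (r : C) n (x : {ffun 'I_n -> X}) :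
  reflexive e -> symmetric e -> 0 <= r ->
  (forall a b, `|w a b| <= if e a b then 1 else r ^+ 2) ->
  `|\prod_(i < n) \prod_(j < n | (i < j)%N) w (x i) (x j)| <= r ^+ edefect e x.
Proof.
move=> exx eC r0 we; pose u i j := if e (x i) (x j) then 1 else r ^+ 2.
have u0 i j : 0 <= u i j by rewrite /u; case: (e _ _); rewrite ?ler01 ?exprn_ge0.
have -> : r ^+ edefect e x = \prod_(i < n) \prod_(j < n | (i < j)%N) u i j.
  apply/eqP; rewrite -(@eqrXn2 _ 2)//; last 2 first.
  - exact: exprn_ge0.
  - by apply: prodr_ge0 => i _; apply: prodr_ge0 => j _; exact: u0.
  rewrite prod_lt_sqr; last 2 first.
  - by move=> i; rewrite /u exx.
  - by move=> i j; rewrite /u eC.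
  rewrite pair_big /= (bigID (fun p : 'I_n * 'I_n => e (x p.1) (x p.2)))/= big1; last first.
    by move=> p; rewrite /u => ->.
  rewrite mul1r (eq_bigr (fun=> r ^+ 2)); last by move=> p /negPf ne; rewrite /u ne.
  by rewrite prodr_const -exprM mulnC exprM /edefect cardsE.
rewrite normr_prod; apply: ler_prod => i _; rewrite normr_ge0 /= normr_prod.
by apply: ler_prod => j _; rewrite normr_ge0 /=; exact: we.
Qed.

Lemma mean_Sur (C : numClosedFieldType) N (N1 : (1 < N)%N) (G : finZmodType) n
    (q : C) (p : simple_graph n.+1 -> C) :
  (forall a : G, a *+ N = 0) ->
  (forall J : {set {set 'I_n.+1}}, J \subset all_edges n.+1 ->
    \sum_(g | J \subset edges g) p g = q ^+ #|J|) ->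
  (\sum_g p g * (ncard (Sur (sandpile g) G))%:R) * #|G|%:R ^+ n.+2 =
  \sum_(x : {ffun 'I_n.+1 -> dual N G * G} | generating (snds x))
    \prod_(i < n.+1) \prod_(j < n.+1 | (i < j)%N)
      (1 - q + q * zchar C N1 (defect (x i) (x j))).
Proof.
move=> tors pE; under [RHS]eq_bigr do rewrite -(mean_edge_product pE).
rewrite exchange_big mulr_suml; apply: eq_bigr => g _ /=.
rewrite -mulr_sumr -(sum_annihilates C N1 tors (@generating n.+1 G)).
by rewrite -ncard_Sur_mul natrM exprS -!mulrA; congr (_ * _); rewrite mulrCA mulrA.
Qed.

Lemma norm_mix_lt1 (C : numClosedFieldType) (q z : C) : 0 < q -> q < 1 ->
  `|z| = 1 -> `|1 - q + q * z| <= 1 ?= iff (z == 1).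
Proof.
move=> q0 q1 z1; have qr : q^* = q by apply: conj_Creal; exact: gtr0_real.
have zz : z * z^* = 1 by rewrite -normCK z1 expr1n.
have E : `|1 - q + q * z| ^+ 2 = 1 - q * (1 - q) * `|1 - z| ^+ 2.
  rewrite !normCK !rmorphD !rmorphM !rmorphN !rmorph1 /= qr /=.
  by ring: zz.
have qq : 0 < q * (1 - q) by rewrite mulr_gt0// subr_gt0.
split.
  rewrite -(@ler_pXn2r _ 2)// ?nnegrE// expr1n E lerBlDr lerDl.
  by rewrite mulr_ge0 ?exprn_ge0// ltW.
rewrite -(@eqrXn2 _ 2)// expr1n E subr_eq addrC -subr_eq subrr eq_sym.
by rewrite mulf_eq0 gt_eqF//= sqrf_eq0 normr_eq0 subr_eq0 eq_sym.
Qed.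

(** * The law of the random graph *)

Lemma erdos_renyi_law (d : measure_display) (T : measurableType d) (R : realType)
    (P : probability T R) (n : nat) (q : R) (Gamma : T -> simple_graph n) :
  erdos_renyi P q Gamma ->
  exists p : simple_graph n -> R, [/\ forall g, 0 <= p g,
    forall J : {set {set 'I_n}}, J \subset all_edges n ->
      \sum_(g | J \subset edges g) p g = q ^+ #|J| &
    forall h : simple_graph n -> R, (forall g, 0 <= h g) ->
      ('E_P[fun w => h (Gamma w)] = (\sum_g p g * h g)%:E)%E].
Proof.
move=> [mE qE indep]; pose A g := [set w | Gamma w = g].
have mA g : measurable (A g).
  pose B (e : {set 'I_n}) := [set w | (e \in edges (Gamma w)) = (e \in edges g)].
  have -> : A g = \bigcap_(e in [set` all_edges n]) B e.
    apply/seteqP; split=> [w wg e _|w Bw]; first by rewrite /B /= wg.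
    apply/val_inj/setP => e.
    have [ee|ne] := boolP (e \in all_edges n); first exact: Bw.
    have nh (h : simple_graph n) : (e \in edges h) = false.
      by apply: contraNF ne; exact: (fintype.subsetP (edges_sub h)).
    by rewrite !nh.
  apply: fin_bigcap_measurable => [|e ee]; first exact: finite_finset.
  rewrite /B; case: (e \in edges g); first exact: mE.
  rewrite [X in measurable X](_ : _ = ~` [set w | e \in edges (Gamma w)]).
    exact/measurableC/mE.
  by apply/seteqP; split=> w /=; [move=> ->|move=> /negP/negbTE].
pose p g := fine (P (A g)).
have pE g : P (A g) = (p g)%:E by rewrite fineK// fin_num_measure.
have law (h : simple_graph n -> R) : (forall g, 0 <= h g) ->
    (\int[P]_w (h (Gamma w))%:E = (\sum_g p g * h g)%:E)%E.
  move=> h0; transitivity (\int[P]_w (\sum_g (h g)%:E * (\1_(A g) w)%:E))%E.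
    apply: eq_integral => w _; rewrite (bigD1 (Gamma w))//= big1 => [|g gw].
      by rewrite indicE mem_set ?mule1 ?adde0.
    by rewrite indicE memNset ?mule0//= => wg; rewrite wg eqxx in gw.
  rewrite ge0_integral_sum//; last 2 first.
  - move=> g; apply: measurable_funeM; exact/measurable_EFinP/measurable_indic.
  - by move=> g w _; rewrite -EFinM lee_fin mulr_ge0.
  rewrite -sumEFin; apply: eq_bigr => g _.
  rewrite ge0_integralZl_EFin//; last exact/measurable_EFinP/measurable_indic.
  by rewrite integral_indic// setIT EFinM muleC; congr (_ * _)%E; exact: pE.
exists p; split.
- by move=> g; rewrite fine_ge0.
- move=> J Jsub; apply: EFin_inj.
  pose B := \bigcap_(e in [set` J]) [set w | e \in edges (Gamma w)].
  have mB : measurable B.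
    apply: fin_bigcap_measurable => [|e eJ]; first exact: finite_finset.
    by apply: mE; exact: (fintype.subsetP Jsub).
  transitivity (P B).
    transitivity (\int[P]_w (\1_B w)%:E)%E; last by rewrite integral_indic// setIT.
    transitivity (\int[P]_w ((J \subset edges (Gamma w))%:R : R)%:E)%E.
      rewrite (law (fun g => (J \subset edges g)%:R))//; congr EFin.
      rewrite big_mkcond; apply: eq_bigr => g _.
      by case: ifP => _; rewrite ?mulr1 ?mulr0.
    apply: eq_integral => w _; rewrite indicE; congr ((nat_of_bool _)%:R%:E).
    apply/fintype.subsetP/idP => [sub|/set_mem sub e eJ]; last exact: sub.
    by apply/mem_set => e /= eJ; exact: sub.
  rewrite indep// (eq_bigr (fun=> q%:E)); last first.
    by move=> e eJ; apply: qE; exact: (fintype.subsetP Jsub).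
  by rewrite prodEFin prodr_const.
- by move=> h h0; rewrite unlock law.
Qed.

(** * Asymptotics of the mean *)

Definition surjb (I T : finType) (v : {ffun I -> T}) : bool :=
  [forall t, exists i, v i == t].

Lemma surjbP (I T : finType) (v : {ffun I -> T}) :
  reflect (forall t, exists i, v i = t) (surjb v).
Proof.
apply: (iffP forallP) => sv t.
  by have /existsP[i /eqP] := sv t; exists i.
by have [i <-] := sv t; apply/existsP; exists i.
Qed.

Lemma card_surjb_ge (I T : finType) :
  (#|T| ^ #|I| <= #|[set v : {ffun I -> T} | surjb v]%SET| + #|T| * #|T|.-1 ^ #|I|)%N.
Proof.
have <- : #|[set: {ffun I -> T}]%SET| = (#|T| ^ #|I|)%N by rewrite cardsT card_ffun.
rewrite -(cardsID [set v | surjb v]%SET [set: {ffun I -> T}]%SET) leq_add//.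
  by rewrite subset_leq_card// finset.subsetIr.
pose M t : {set {ffun I -> T}} := [set v in ffun_on (predC1 t)]%SET.
apply: (@leq_trans #|\bigcup_t M t|%SET).
  apply/subset_leq_card/fintype.subsetP => v; rewrite !inE andbT => /forallPn[t].
  rewrite negb_exists => /forallP vt; apply/bigcupP; exists t => //.
  by rewrite inE; apply/ffun_onP => i; rewrite inE vt.
apply: (@leq_trans (\sum_t #|M t|)%N).
  elim/big_rec2: _ => [|t m B _ Bm]; first by rewrite cards0.
  by apply: (leq_trans (leq_card_setU _ _)); rewrite leq_add2l.
rewrite (eq_bigr (fun=> (#|T|.-1 ^ #|I|)%N)) ?sum_nat_const// => t _.
by rewrite cardsE card_ffun_on cardC1.
Qed.

Section main_term.
Variables (N : nat) (G : finZmodType) (n : nat).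
Hypothesis N1 : (1 < N)%N.
Hypothesis tors : forall a : G, a *+ N = 0.
Local Notation X := (dual N G * G)%type.

Definition max_clique (x : {ffun 'I_n -> X}) : bool :=
  clique compat (vimage x) && (#|vimage x| == #|G|).

Lemma card_max_clique :
  #|[set x : {ffun 'I_n -> X} | generating (snds x) && max_clique x]%SET| =
  (#|G| * ncard [set: ext2 G] * #|[set v : {ffun 'I_n -> G} | surjb v]%SET|)%N.
Proof.
rewrite -(card_clique_fun N1 tors) -cardsX.
pose graph (u : {ffun G -> dual N G} * {ffun 'I_n -> G}) : {ffun 'I_n -> X} :=
  [ffun i => (u.1 (u.2 i), u.2 i)].
rewrite -(card_in_imset (f := graph)); last first.
  move=> [a v] [b w] /setXP[_ +] _ /ffunP E; rewrite inE => /surjbP sv.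
  have vw : v = w by apply/ffunP => i; have := E i; rewrite !ffunE => -[].
  congr (_, _) => //; apply/ffunP => g; have [i <-] := sv g.
  by have := E i; rewrite !ffunE /= -vw => -[].
apply: eq_card => x; rewrite [LHS]inE; apply/and3P/imsetP.
  move=> [gx cx /eqP kx].
  have [|a aP Hx] := max_clique_graph cx kx.
    move=> c cc; apply: (generating_dual gx) => i j.
    by rewrite !ffunE; apply: cc; apply: imset_f.
  have xa i : x i = (a (x i).2, (x i).2).
    have : x i \in vimage x by apply: imset_f.
    by rewrite Hx => /imsetP[g _ ->].
  exists (a, snds x); last by apply/ffunP => i; rewrite !ffunE.
  apply/setXP; split; rewrite inE.
    by apply/forallP => g; apply/forallP => h; exact: aP.
  apply/surjbP => g; have : (a g, g) \in vimage x by rewrite Hx; apply: imset_f.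
  by move=> /imsetP[i _ xi]; exists i; rewrite ffunE -xi.
move=> [[a v] /setXP[+ +] ->]; rewrite !inE => aP /surjbP sv.
have snds_graph : snds (graph (a, v)) = v by apply/ffunP => i; rewrite !ffunE.
have im : vimage (graph (a, v)) = [set (a g, g) | g : G]%SET.
  apply/setP => y; apply/imsetP/imsetP => [[i _ ->]|[g _ ->]].
    by exists (v i) => //; rewrite ffunE.
  by have [i <-] := sv g; exists i => //; rewrite ffunE.
split.
- by rewrite snds_graph; exact: surj_generating.
- rewrite im; apply/cliqueP => _ _ /imsetP[g _ ->] /imsetP[h _ ->].
  by have /forallP/(_ g)/forallP := aP.
- by rewrite im card_imset// => g h [].
Qed.

End main_term.

Section mean_asymptotics.
Variables (R : realType) (q : R) (G : finZmodType).
Hypotheses (q_gt0 : 0 < q) (q_lt1 : q < 1).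
Local Notation k := #|G|.
Local Notation "x %:K" := (real_complex R x) (at level 2, format "x %:K").

(* The exponent of G would do, but ['Z_N] is Z/N only for N > 1. *)
Let N := (k * 2)%N.

Let k_gt0 : (0 < k)%N. Proof. by apply/card_gt0P; exists 0. Qed.

Let N1 : (1 < N)%N. Proof. by rewrite /N; lia. Qed.

Let tors (a : G) : a *+ N = 0.
Proof.
suff ak : a *+ k = 0 by rewrite /N mulrnA ak mul0rn.
apply: (addrI (\sum_(x : G) x)).
by rewrite addr0 [RHS](reindex_inj (addIr a)) big_split sumr_const.
Qed.

Local Notation X := (dual N G * G)%type.

Let w (a b : X) : R[i] := 1 - q%:K + q%:K * zchar R[i] N1 (defect a b).

Let w_compat a b : compat a b -> w a b = 1.
Proof. by rewrite -defect_eq0 /w => /eqP->; rewrite zchar0 mulr1 subrK. Qed.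

Let w_bound : exists r : R, [/\ 0 <= r, r < 1 &
  forall a b, `|w a b| <= if compat a b then 1 else r%:K ^+ 2].
Proof.
pose nw (u : X * X) := complex.Re `|w u.1 u.2|.
have nwE a b : (nw (a, b))%:K = `|w a b| by apply: RRe_real; exact: normr_real.
pose m := \big[Num.max/0]_(u : X * X | ~~ compat u.1 u.2) nw u.
have m0 : 0 <= m by exact: bigmax_ge_id.
have m1 : m < 1.
  apply: bigmax_lt => // -[a b] /= nab; rewrite -ltcR nwE.
  have [le1 eq1] : `|w a b| <= 1 ?= iff (zchar R[i] N1 (defect a b) == 1).
    by apply: norm_mix_lt1; rewrite ?zchar_norm// ?ltcR.
  by rewrite lt_neqAle eq1 zchar_eq1 defect_eq0 nab le1.
exists (Num.sqrt m); rewrite sqrtr_ge0; split=> //.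
  by rewrite -sqrtr1 ltr_sqrt.
move=> a b; case: ifPn => [ab|nab]; first by rewrite w_compat// normr1.
rewrite -rmorphXn /= sqr_sqrtr// -nwE lecR.
exact: (le_bigmax_cond _ (fun u => nw u) (nab : ~~ compat (a, b).1 (a, b).2)).
Qed.

Lemma mean_Sur_asymptotics : exists c K : R, [/\ 0 < c, 0 < K &
  forall n (p : simple_graph n.+1 -> R),
    (forall J : {set {set 'I_n.+1}}, J \subset all_edges n.+1 ->
      \sum_(g | J \subset edges g) p g = q ^+ #|J|) ->
    `|\sum_g p g * (ncard (Sur (sandpile g) G))%:R - (ncard [set: ext2 G])%:R|
      <= K * expR (- c * n.+1%:R)].
Proof.
have [r [r0 r1 wr]] := w_bound.
have [c [K [c0 K0 cK]]] := sum_edefect (@compatxx N G) (@compat_sym N G) k_gt0 r0 r1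
  (clique_card N1 tors).
have kR : 1 <= k%:R :> R by rewrite ler1n.
set W := ncard [set: ext2 G].
exists (Num.min c k%:R^-1), (W%:R * k%:R + K); split.
- by rewrite lt_min c0 invr_gt0; lra.
- by rewrite ltr_wpDl ?mulr_ge0.
move=> n p pE; set E := \sum_g _; set m := n.+1.
pose S := #|[set x : {ffun 'I_m -> X} | generating (snds x) && max_clique x]%SET|.
pose D := \sum_(x : {ffun 'I_m -> X} | ~~ max_clique x) r ^+ edefect compat x.
have ES : `|E * k%:R ^+ m.+1 - S%:R| <= D.
  rewrite -lecR; have -> : (`|E * k%:R ^+ m.+1 - S%:R|)%:K = `|E%:K * k%:R ^+ m.+1 - S%:R|.
    have <- : (E * k%:R ^+ m.+1 - S%:R)%:K = E%:K * k%:R ^+ m.+1 - S%:R.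
      by rewrite rmorphB rmorphM rmorphXn !rmorph_nat.
    by rewrite normc_def /= expr0n addr0 sqrtr_sqr.
  have -> : E%:K = \sum_g (p g)%:K * (ncard (Sur (sandpile g) G))%:R.
    by rewrite rmorph_sum; apply: eq_bigr => g _; rewrite rmorphM rmorph_nat.
  rewrite (@mean_Sur R[i] N N1 G n q%:K _ tors); last first.
    by move=> J /pE JE; rewrite -rmorphXn -JE rmorph_sum.
  rewrite (bigID (@max_clique N G m))/= [X in X + _ - _](_ : _ = S%:R); last first.
    rewrite /S -sum1dep_card natr_sum; apply: eq_bigr => x /andP[_ /andP[/cliqueP cx _]].
    rewrite big1// => i _; rewrite big1// => j _; apply: w_compat.
    by apply: cx; apply: imset_f.
  rewrite addrC addrA addNr add0r rmorph_sum.
  apply: (le_trans (ler_norm_sum _ _ _)).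
  rewrite [leRHS](bigID (fun x => generating (snds x)))/= -[leLHS]addr0 lerD//; last first.
    by apply: sumr_ge0 => x _; rewrite ler0c exprn_ge0.
  under [leRHS]eq_bigl do rewrite andbC.
  apply: ler_sum => x _; rewrite rmorphXn.
  by apply: (norm_pair_product (w := w)); rewrite ?ler0c//;
    [exact: compatxx|exact: compat_sym].
have DK : D <= K * expR (- c * m%:R) * k%:R ^+ m by exact: cK.
have SE : S = (k * W * #|[set v : {ffun 'I_m -> G} | surjb v]%SET|)%N.
  exact: (card_max_clique m N1 tors).
have surj_le : (#|[set v : {ffun 'I_m -> G} | surjb v]%SET| <= k ^ m)%N.
  by apply: (leq_trans (max_card _)); rewrite card_ffun card_ord.
have surj_ge := card_surjb_ge 'I_m G; rewrite card_ord in surj_ge.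
set s := #|_|%SET in SE surj_le surj_ge.
have SW : `|S%:R - W%:R * k%:R ^+ m.+1| <= W%:R * k%:R * (k%:R * (k.-1)%:R ^+ m) :> R.
  rewrite SE !natrM exprS mulrA [k%:R * W%:R]mulrC -mulrBr normrM ger0_norm ?mulr_ge0//.
  rewrite ler_wpM2l ?mulr_ge0// distrC ger0_norm ?subr_ge0 -natrX ?ler_nat//.
  by rewrite lerBlDl -natrX -natrM -natrD ler_nat.
have km0 : 0 < k%:R ^+ m :> R by rewrite exprn_gt0; lra.
have kexp : (k.-1)%:R ^+ m <= k%:R ^+ m * expR (- k%:R^-1 * m%:R) :> R.
  rewrite expRM_natr -exprMn lerXn2r ?nnegrE ?mulr_ge0 ?expR_ge0//.
  apply: (@le_trans _ _ (k%:R * (1 + - k%:R^-1))).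
    by rewrite mulrDr mulr1 mulrN divff ?gt_eqF//; [rewrite -subn1 natrB//|lra].
  by rewrite ler_wpM2l ?expR_ge1Dx.
rewrite -(@ler_pM2r _ (k%:R ^+ m.+1)) ?exprn_gt0//; last lra.
rewrite -{1}[k%:R ^+ m.+1]ger0_norm ?exprn_ge0// -normrM mulrBl.
have -> : E * k%:R ^+ m.+1 - W%:R * k%:R ^+ m.+1 =
  (E * k%:R ^+ m.+1 - S%:R) + (S%:R - W%:R * k%:R ^+ m.+1) by rewrite addrA subrK.
apply: (le_trans (ler_normD _ _)).
apply: (le_trans (lerD (le_trans ES DK) SW)).
set e := expR (- Num.min _ _ * _).
have e1 : expR (- c * m%:R) <= e by rewrite ler_expR ler_wpM2r// lerN2 ge_min lexx.
have e2 : expR (- k%:R^-1 * m%:R) <= e.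
  by rewrite ler_expR ler_wpM2r// lerN2 ge_min lexx orbT.
have e0 : 0 <= e by exact: expR_ge0.
rewrite exprS; set T := k%:R ^+ m in km0 kexp *.
have -> : (W%:R * k%:R + K) * e * (k%:R * T) =
  K * e * (k%:R * T) + W%:R * k%:R * (k%:R * (T * e)) by ring.
apply: lerD.
  apply: (@le_trans _ _ (K * e * T)); first by rewrite ler_pM2r// ler_pM2l.
  by rewrite ler_wpM2l ?mulr_ge0 ?(ltW K0)// ler_peMl// ltW.
rewrite ler_wpM2l ?mulr_ge0// ler_wpM2l//.
by apply: (le_trans kexp); rewrite ler_pM2l.
Qed.

End mean_asymptotics.

Theorem theorem6p2 (R : realType) (q : R) (q_gt0 : 0 < q) (q_lt1 : q < 1)
    (G : finZmodType) :
  exists c K : R, [/\ 0 < c, 0 < K &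
    forall (n : nat) (d : measure_display) (T : measurableType d)
      (P : probability T R) (Gamma : T -> simple_graph n),
      erdos_renyi P q Gamma ->
      (`| 'E_P[fun w => (ncard (Sur (sandpile (Gamma w)) G))%:R]
          - (ncard [set: ext2 G])%:R%:E |
        <= (K * expR (- c * n%:R))%:E)%E].
Proof.
have [c [K [c0 K0 cK]]] := mean_Sur_asymptotics G q_gt0 q_lt1.
pose S0 : R := \sum_(g : simple_graph 0) (ncard (Sur (sandpile g) G))%:R.
set W := ncard [set: ext2 G].
have S00 : 0 <= S0 by exact: sumr_ge0.
exists c, (K + (S0 + W%:R)); split=> //; first by rewrite ltr_wpDr ?addr_ge0.
move=> n d T P Gamma /erdos_renyi_law[p [p0 pJ pE]].
rewrite (pE (fun g => (ncard (Sur (sandpile g) G))%:R))// {pE}.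
rewrite -EFinB abse_EFin lee_fin; case: n => [|n] in Gamma p p0 pJ *; last first.
  apply: (le_trans (cK n p pJ)).
  by rewrite ler_wpM2r ?expR_ge0// lerDl addr_ge0.
rewrite mulr0 expR0 mulr1; apply: (@le_trans _ _ (S0 + W%:R)); last by rewrite lerDr ltW.
apply: (le_trans (ler_normB _ _)); rewrite normr_nat lerD2r ger0_norm; last first.
  by apply: sumr_ge0 => g _; rewrite mulr_ge0.
apply: ler_sum => g _; apply: ler_piMl => //.
have /(_ finset.set0) := pJ; rewrite cards0 expr0 => <-; last exact: finset.sub0set.
rewrite (bigD1 g) ?finset.sub0set//= lerDl.
by apply: sumr_ge0.
Qed.
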